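(* Let $C$ be a set of constant symbols and $\Sigma$ an $\mathcal{L}_{\rm ring}(C)$-theory containing the theory of fields, such that $\mathrm{rk}^{\exists}_{\Sigma_p}(\pi_{n,p^m})\leq 1$ for every prime number $p$ and all $n,m\in\mathbb{N}_{\geq 1}$. Then for every existential $\mathcal{L}_{\rm ring}(C)$-formula $\varphi$, $$\mathrm{efd}_\Sigma(\varphi)=\max\{\mathrm{rk}^{\exists^+}_\Sigma(\varphi)-1,\,0\}.$$
   Context: $\mathcal{L}_{\rm ring}(C)$ is the language of rings $\{+,-,\cdot,0,1\}$ extended by the constant symbols in $C$. Existential formulas are built from quantifier-free formulas by $\wedge,\vee,\exists$; positive existential formulas are built from atomic formulas by $\wedge,\vee,\exists$ (no negation). For a theory $\Sigma$ and formula $\varphi$, $\mathrm{rk}^{\exists}_\Sigma(\varphi)$ is the infimum of $m\in\mathbb{N}_0$ such that $\varphi$ is equivalent modulo $\Sigma$ (i.e. $\Sigma\models\forall\underline X(\varphi\leftrightarrow\psi)$) to a formula $\psi=\exists Y_1,\dots,Y_m\,\chi$ with $\chi$ quantifier-free; $\mathrm{rk}^{\exists^+}_\Sigma(\varphi)$ is defined the same way requiring $\chi$ quantifier-free and negation-free. For a prime $p$, $\Sigma_p=\Sigma\cup\{p\doteq 0\}$. For $n,m\geq1$, $\pi_{n,m}(X_1,\dots,X_n)$ is the formula $\exists Y_1,\dots,Y_n\bigwedge_{i=1}^n X_i\doteq Y_i^m$. For a model $K$ of $\Sigma$, $K_C$ denotes the subfield of $K$ generated by the interpretations of the constants in $C$.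 For an existential formula $\varphi(X_1,\dots,X_n)$, the essential fibre dimension $\mathrm{efd}_\Sigma(\varphi)$ is the least $d\in\mathbb{N}_0$ such that for every $K\models\Sigma$ and every $\underline x\in K^n$ with $K\models\varphi(\underline x)$ there is an intermediate field $K_C(\underline x)\subseteq K'\subseteq K$ with $\mathrm{trdeg}(K'/K_C(\underline x))\leq d$ such that $L\models\varphi(\rho(\underline x))$ for every $L\models\Sigma$ and every $\mathcal{L}_{\rm ring}(C)$-embedding $\rho\colon K'\to L$. *)

(* Defs.v *)
From mathcomp Require Import all_boot all_order all_algebra.
From mathcomp Require Import boolp classical_sets.
From mathcomp.multinomials Require Import mpoly.

Set Implicit Arguments.
Unset Strict Implicit.
Unset Printing Implicit Defensive.

Import GRing.Theory.

Local Open Scope ring_scope.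
Local Open Scope classical_set_scope.

Inductive term (C : Type) (n : nat) : Type :=
| Var of 'I_n
| Cst of C
| Zero
| One
| Add of term C n & term C n
| Opp of term C n
| Mul of term C n & term C n.

Arguments Zero {C n}.
Arguments One {C n}.
Arguments Var {C n} _.
Arguments Cst {C n} _.

(* [formula C n]: formulas in the free variables X_1, ..., X_n, represented by
   the elements of ['I_n].  A quantifier binds the variable [ord0] of its body
   and the variable [i] outside is the variable [lift ord0 i] of the body. *)
Inductive formula (C : Type) : nat -> Type :=
| Eq n of term C n & term C n : formula C n
| Not n of formula C n : formula C n
| And n of formula C n & formula C n : formula C n
| Or n of formula C n & formula C n : formula C n
| Ex n of formula C n.+1 : formula C n
| All n of formula C n.+1 : formula C n.

Definition sentence (C : Type) := formula C 0.

Record structure (C : Type) := Structure {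
  sdom :> Type;
  szero : sdom;
  sone : sdom;
  sadd : sdom -> sdom -> sdom;
  sopp : sdom -> sdom;
  smul : sdom -> sdom -> sdom;
  scst : C -> sdom }.

Arguments szero {C} _.
Arguments sone {C} _.
Arguments scst {C} _ _.

Definition scons (T : Type) n (a : T) (e : 'I_n -> T) : 'I_n.+1 -> T :=
  fun i => oapp e a (unlift ord0 i).

Definition noval (T : Type) : 'I_0 -> T :=
  fun i => False_rect T (notF (ltn_ord i)).

Fixpoint eval C (M : structure C) n (e : 'I_n -> M) (t : term C n) : M :=
  match t with
  | Var i => e i
  | Cst c => scst M c
  | Zero => szero M
  | One => sone M
  | Add t u => sadd (eval e t) (eval e u)
  | Opp t => sopp (eval e t)
  | Mul t u => smul (eval e t) (eval e u)
  end.

Fixpoint sat C (M : structure C) n (f : formula C n) : ('I_n -> M) -> Prop :=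
  match f with
  | Eq _ t u => fun e => eval e t = eval e u
  | Not _ f => fun e => ~ sat f e
  | And _ f g => fun e => sat f e /\ sat g e
  | Or _ f g => fun e => sat f e \/ sat g e
  | Ex _ f => fun e => exists a : M, sat f (scons a e)
  | All _ f => fun e => forall a : M, sat f (scons a e)
  end.

Definition models C (M : structure C) (Sigma : set (sentence C)) : Prop :=
  forall s, Sigma s -> sat s (@noval M).

Definition equiv_mod C (Sigma : set (sentence C)) n (f g : formula C n) :=
  forall M : structure C, models M Sigma ->
    forall e : 'I_n -> M, sat f e <-> sat g e.

Fixpoint qf C n (f : formula C n) : bool :=
  match f with
  | Eq _ _ _ => true
  | Not _ f => qf f
  | And _ f g | Or _ f g => qf f && qf g
  | Ex _ _ | All _ _ => false
  end.

Fixpoint qf_pos C n (f : formula C n) : bool :=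
  match f with
  | Eq _ _ _ => true
  | And _ f g | Or _ f g => qf_pos f && qf_pos g
  | Not _ _ | Ex _ _ | All _ _ => false
  end.

Inductive existential C : forall n, formula C n -> Prop :=
| existential_qf n (f : formula C n) : qf f -> existential f
| existential_and n (f g : formula C n) :
    existential f -> existential g -> existential (And f g)
| existential_or n (f g : formula C n) :
    existential f -> existential g -> existential (Or f g)
| existential_ex n (f : formula C n.+1) : existential f -> existential (Ex f).

(* In the body of [exs m], of type [formula C (m + n)], the quantified
   variables are the [lshift n j] with [j : 'I_m], and the free variable X_i is
   [rshift m i]. *)
Fixpoint exs C n m : formula C (m + n) -> formula C n :=
  match m with
  | 0 => id
  | m'.+1 => fun f => exs (Ex f : formula C (m' + n))
  end.

Definition pow_term C n (t : term C n) (m : nat) : term C n :=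
  iter m (Mul t) One.

Definition nat_term C n (k : nat) : term C n := iter k (Add One) Zero.

Definition top C n : formula C n := Eq Zero Zero.

Definition pi_formula C (n m : nat) : formula C n :=
  @exs C n n (\big[@And C (n + n)/top C (n + n)]_(i < n)
    Eq (Var (rshift n i)) (pow_term (Var (lshift n i)) m)).

Local Notation "''v[' n , k ]" := (Var (@Ordinal n k isT)).

Inductive field_theory (C : Type) : sentence C -> Prop :=
| ax_addA : field_theory (All (All (All (Eq
    (Add 'v[3, 0] (Add 'v[3, 1] 'v[3, 2]))
    (Add (Add 'v[3, 0] 'v[3, 1]) 'v[3, 2])))))
| ax_addC : field_theory (All (All (Eq
    (Add 'v[2, 0] 'v[2, 1]) (Add 'v[2, 1] 'v[2, 0]))))
| ax_add0 : field_theory (All (Eq (Add 'v[1, 0] Zero) 'v[1, 0]))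
| ax_addN : field_theory (All (Eq (Add 'v[1, 0] (Opp 'v[1, 0])) Zero))
| ax_mulA : field_theory (All (All (All (Eq
    (Mul 'v[3, 0] (Mul 'v[3, 1] 'v[3, 2]))
    (Mul (Mul 'v[3, 0] 'v[3, 1]) 'v[3, 2])))))
| ax_mulC : field_theory (All (All (Eq
    (Mul 'v[2, 0] 'v[2, 1]) (Mul 'v[2, 1] 'v[2, 0]))))
| ax_mul1 : field_theory (All (Eq (Mul 'v[1, 0] One) 'v[1, 0]))
| ax_mulD : field_theory (All (All (All (Eq
    (Mul 'v[3, 0] (Add 'v[3, 1] 'v[3, 2]))
    (Add (Mul 'v[3, 0] 'v[3, 1]) (Mul 'v[3, 0] 'v[3, 2]))))))
| ax_nontrivial : field_theory (Not (Eq Zero One))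
| ax_inv : field_theory (All (Or (Eq 'v[1, 0] Zero)
    (Ex (Eq (Mul 'v[2, 1] 'v[2, 0]) One)))).

Arguments field_theory C _ : clear implicits.

Definition theory_char C (Sigma : set (sentence C)) (p : nat) :=
  Sigma `|` [set Eq (nat_term C 0 p) Zero].

(* The infimum in N_0 U {oo}, where [None] stands for oo. *)
Definition natinf (S : set nat) : option nat :=
  match pselect (exists m, `[< S m >]) with
  | left exS => Some (ex_minn exS)
  | right _ => None
  end.

Definition natinf_le (r : option nat) (m : nat) : bool :=
  if r is Some k then (k <= m)%N else false.

Definition rk_ex C (Sigma : set (sentence C)) n (f : formula C n) :=
  natinf [set m | exists2 chi : formula C (m + n),
                    qf chi & equiv_mod Sigma f (exs chi)].

Definition rk_ex_pos C (Sigma : set (sentence C)) n (f : formula C n) :=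
  natinf [set m | exists2 chi : formula C (m + n),
                    qf_pos chi & equiv_mod Sigma f (exs chi)].

Definition subfield (K : fieldType) (F : set K) : Prop :=
  GRing.divring_closed (mem F).

Definition gen_subfield (K : fieldType) (A : set K) : set K :=
  smallest (@subfield K) A.

Definition algebraic_over (K : fieldType) (F : set K) (a : K) : Prop :=
  exists p : {poly K}, [/\ p != 0, forall i, F p`_i & root p a].

Definition alg_independent (K : fieldType) (F : set K) n (t : 'I_n -> K) :=
  forall p : {mpoly K[n]}, (forall m, F p@_m) -> p.@[t] = 0 -> p = 0.

Definition transcendence_basis (K : fieldType) (F E : set K) n (t : 'I_n -> K) :=
  [/\ forall i, E (t i), alg_independent F t &
      forall a, E a -> algebraic_over (gen_subfield (F `|` range t)) a].

Definition trdeg_le (K : fieldType) (E F : set K) (d : nat) : Prop :=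
  exists n (t : 'I_n -> K), (n <= d)%N /\ transcendence_basis F E t.

Definition field_structure C (K : fieldType) (c : C -> K) : structure C :=
  @Structure C K 0 1 +%R -%R *%R c.

(* A map defined on the substructure [A] of [M] is represented by a total map
   on [M], whose values outside [A] are irrelevant. *)
Record embedding_on C (M N : structure C) (A : set M) (rho : M -> N) : Prop := {
  emb_inj : forall a b, A a -> A b -> rho a = rho b -> a = b;
  emb_zero : rho (szero M) = szero N;
  emb_one : rho (sone M) = sone N;
  emb_add : forall a b, A a -> A b -> rho (sadd a b) = sadd (rho a) (rho b);
  emb_opp : forall a, A a -> rho (sopp a) = sopp (rho a);
  emb_mul : forall a b, A a -> A b -> rho (smul a b) = smul (rho a) (rho b);
  emb_cst : forall c, rho (scst M c) = scst N c }.

(* If [Sigma] contains the theory of fields then its models are, up to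
   isomorphism, the structures [field_structure cK]. *)
Definition fibre_dim_le C (Sigma : set (sentence C)) n (f : formula C n)
    (d : nat) : Prop :=
  forall (K : fieldType) (cK : C -> K), models (field_structure cK) Sigma ->
  forall x : 'I_n -> K, @sat C (field_structure cK) n f x ->
  let KCx := gen_subfield (range cK `|` range x) in
  exists K' : set K,
    [/\ subfield K', KCx `<=` K', trdeg_le K' KCx d &
        forall (L : fieldType) (cL : C -> L), models (field_structure cL) Sigma ->
        forall rho : K -> L,
          @embedding_on C (field_structure cK) (field_structure cL) K' rho ->
          @sat C (field_structure cL) n f (fun i => rho (x i))].

Definition efd C (Sigma : set (sentence C)) n (f : formula C n) : option nat :=
  natinf (fibre_dim_le Sigma f).

(* Main.v *)
Require Import Defs.
From Stdlib Require List.
From HB Require Import structures.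
From mathcomp Require Import all_boot all_algebra cyclic separable.
From mathcomp Require Import boolp classical_sets filter.
From mathcomp.multinomials Require Import mpoly.

Set Implicit Arguments.
Unset Strict Implicit.
Unset Printing Implicit Defensive.

Import GRing.Theory.

Local Open Scope ring_scope.
Local Open Scope classical_set_scope.

(** If [phi] is equivalent to [exists y_1 .. y_m, chi] with [chi] positive, take a
    solution [y] over [x].  If [y] is algebraically independent over [K_C(x)], the
    equations of [chi] satisfied by [y] are identities, so [y] may be replaced by
    [0] and [K_C(x)] is large enough; otherwise [K_C(x, y)] has transcendence
    degree at most [m - 1].

    Conversely let [K'] have transcendence degree at most [d] over [K_C(x)], with
    transcendence basis [t], and put [F = K_C(x, t)].  By compactness a finite
    part [S] of [K'] already forces [phi].  If [S] lies in a simple algebraic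
    extension [F(a)] (finite [F], or separable [S]), keep [F(a)].  In general the
    [q]-th powers of [S] are separable over [F] for some power [q] of the
    characteristic, and the hypothesis on [pi_{n,q}] says that one more element
    [w] certifies that they are [q]-th powers; [w] can be chosen algebraic over
    [F], and the primitive element theorem, which tolerates one inseparable
    generator, gives [F(a)] again.  Now [F(a)] is the directed union of the rings
    [Z[C, x, t, z]], [z] in [F(a)], so a finite part of its positive diagram is
    expressed by polynomial equations in the [d + 1] unknowns [t, z].  A second
    use of compactness leaves finitely many such systems of equations. *)

(** * Assignments, substitution, finite conjunctions and disjunctions *)

Definition vcat (T : Type) m n (v : 'I_m -> T) (e : 'I_n -> T) : 'I_(m + n) -> T :=
  fun i => match split i with inl j => v j | inr j => e j end.

Lemma vcat_lshift (T : Type) m n (v : 'I_m -> T) (e : 'I_n -> T) i :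
  vcat v e (lshift n i) = v i.
Proof. by rewrite /vcat (unsplitK (inl i)). Qed.

Lemma vcat_rshift (T : Type) m n (v : 'I_m -> T) (e : 'I_n -> T) i :
  vcat v e (rshift m i) = e i.
Proof. by rewrite /vcat (unsplitK (inr i)). Qed.

Lemma comp_vcat (T U : Type) (f : T -> U) m n (v : 'I_m -> T) (e : 'I_n -> T) :
  (fun i => f (vcat v e i)) = vcat (fun i => f (v i)) (fun i => f (e i)).
Proof. by apply: funext => i; rewrite /vcat; case: split. Qed.

Lemma scons_vcat (T : Type) m n a (v : 'I_m -> T) (e : 'I_n -> T) :
  scons a (vcat v e) = vcat (scons a v) e.
Proof.
apply: funext => i; rewrite /scons.
have [j ij|ij] := unliftP ord0 i; last first.
  by rewrite ij (_ : ord0 = lshift n ord0) ?vcat_lshift /= ?unlift_none //; apply: val_inj.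
rewrite ij /=; case: (split_ordP j) => h ->.
  rewrite vcat_lshift (_ : lift ord0 (lshift n h) = lshift n (lift ord0 h)); last exact: val_inj.
  by rewrite vcat_lshift liftK.
rewrite vcat_rshift (_ : lift ord0 (rshift m h) = rshift m.+1 h); last exact: val_inj.
by rewrite vcat_rshift.
Qed.

Lemma sat_exs C (M : structure C) n m (f : formula C (m + n)) (e : 'I_n -> M) :
  sat (exs f) e <-> exists v : 'I_m -> M, sat f (vcat v e).
Proof.
elim: m f => [|m IHm] f.
  have e0 v : @vcat M 0 n v e = e.
    apply: funext => i; have ri : rshift 0 i = i by apply: val_inj.
    by rewrite -[LHS]/(vcat v e i) -[in LHS]ri vcat_rshift.
  split=> [h|[v]]; first by exists (@noval M); rewrite e0.
  by rewrite e0.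
rewrite -[exs f]/(exs (Ex f : formula C (m + n))) IHm.
split=> [[v [a]]|[v h]].
  by rewrite scons_vcat; exists (scons a v).
exists (fun i => v (lift ord0 i)), (v ord0); rewrite scons_vcat.
rewrite (_ : scons _ _ = v) //; apply: funext => i; rewrite /scons.
by case: unliftP => [j ->|->].
Qed.

Fixpoint term_subst C n m (g : 'I_n -> term C m) (t : term C n) : term C m :=
  match t with
  | Var i => g i
  | Cst c => Cst c
  | Zero => Zero
  | One => One
  | Add t u => Add (term_subst g t) (term_subst g u)
  | Opp t => Opp (term_subst g t)
  | Mul t u => Mul (term_subst g t) (term_subst g u)
  end.

(* Only meaningful on quantifier-free formulas. *)
Fixpoint map_terms C n (f : formula C n) :
    forall m, (term C n -> term C m) -> formula C m :=
  match f with
  | Eq _ t u => fun m g => Eq (g t) (g u)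
  | Not _ f => fun m g => Not (map_terms f g)
  | And _ f1 f2 => fun m g => And (map_terms f1 g) (map_terms f2 g)
  | Or _ f1 f2 => fun m g => Or (map_terms f1 g) (map_terms f2 g)
  | Ex _ _ | All _ _ => fun m g => top C m
  end.

Lemma eval_subst C (M : structure C) n m (g : 'I_n -> term C m) (e : 'I_m -> M)
  (t : term C n) : eval e (term_subst g t) = eval (fun i => eval e (g i)) t.
Proof. by elim: t => //= [t -> u ->|t ->|t -> u ->]. Qed.

Lemma qf_pos_qf C n (f : formula C n) : qf_pos f -> qf f.
Proof.
by elim: f => //= {}n f IHf g IHg /andP[/IHf-> /IHg->].
Qed.

Lemma qf_pos_map_terms C n m (f : formula C n) (g : term C n -> term C m) :
  qf_pos f -> qf_pos (map_terms f g).
Proof.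
elim: f m g => //= {}n f1 IH1 f2 IH2 m g /andP[h1 h2];
  exact/andP/(conj (IH1 _ _ h1) (IH2 _ _ h2)).
Qed.

Lemma qf_map_terms C n m (f : formula C n) (g : term C n -> term C m) :
  qf f -> qf (map_terms f g).
Proof.
by elim: f m g => //= {}n f1 IH1 f2 IH2 m g /andP[h1 h2];
   exact/andP/(conj (IH1 _ _ h1) (IH2 _ _ h2)).
Qed.

(** [g] need not be a substitution and [M], [N] may differ: without quantifiers it is enough that
    equations are preserved and reflected. This also covers the Frobenius twist below. *)
Lemma sat_map_terms C (M N : structure C) n m (f : formula C n)
    (g : term C n -> term C m) (e : 'I_n -> M) (e' : 'I_m -> N) :
  (forall t u, eval e' (g t) = eval e' (g u) <-> eval e t = eval e u) ->
  qf f -> sat (map_terms f g) e' <-> sat f e.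
Proof.
elim: f m g e e' => //= [k f IH|k f1 IH1 f2 IH2|k f1 IH1 f2 IH2] m g e e' He.
- by move=> qff; rewrite (IH _ _ e).
- by case/andP=> q1 q2; rewrite (IH1 _ _ e) // (IH2 _ _ e).
- by case/andP=> q1 q2; rewrite (IH1 _ _ e) // (IH2 _ _ e).
Qed.

Lemma sat_subst C (M : structure C) n m (f : formula C n)
    (g : 'I_n -> term C m) (e : 'I_m -> M) :
  qf f -> sat (map_terms f (term_subst g)) e <-> sat f (fun i => eval e (g i)).
Proof. by apply: sat_map_terms => t u; rewrite !eval_subst. Qed.

Lemma sat_bigAnd C (M : structure C) n (T : Type) (s : seq T)
    (F : T -> formula C n) (e : 'I_n -> M) :
  sat (\big[@And C n/top C n]_(a <- s) F a) e <->
  forall a, List.In a s -> sat (F a) e.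
Proof.
elim: s => [|a s IHs]; first by rewrite big_nil.
rewrite big_cons /= IHs; split=> [[ha hs] b [<-|/hs]|h] //.
by split=> [|b hb]; apply: h; [left|right].
Qed.

Lemma qf_pos_bigAnd C n (T : Type) (s : seq T) (F : T -> formula C n) :
  (forall a, qf_pos (F a)) -> qf_pos (\big[@And C n/top C n]_(a <- s) F a).
Proof.
by move=> hF; elim: s => [|a s IHs]; rewrite ?big_nil // big_cons /= hF.
Qed.

(** The empty disjunction is [0 = 1], a positive formula for falsity, whence the hypothesis on
    [M]. *)
Lemma sat_bigOr C (M : structure C) n (s : seq (formula C n)) (e : 'I_n -> M) :
  szero M <> sone M ->
  sat (\big[@Or C n/Eq Zero One]_(f <- s) f) e <->
  exists2 f, List.In f s & sat f e.
Proof.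
move=> M01; elim: s => [|f s IHs]; first by rewrite big_nil; split=> [/M01|[]].
rewrite big_cons /= IHs; split=> [[hf|[g gs hg]]|[g [<-|gs] hg]].
- by exists f => //; left.
- by exists g => //; right.
- by left.
- by right; exists g.
Qed.

Lemma qf_pos_bigOr C n (s : seq (formula C n)) :
  (forall f, List.In f s -> qf_pos f) ->
  qf_pos (\big[@Or C n/Eq Zero One]_(f <- s) f).
Proof.
elim: s => [|f s IHs] h; first by rewrite big_nil.
by rewrite big_cons /= h ?IHs //= => [g gs|]; [apply: h; right|left].
Qed.

(** * Ultraproducts *)

(** The sets containing every list that includes a given one form a proper filter; any ultrafilter
    above it does. *)
Lemma exists_ultra_seq (A : Type) :
  exists2 U : set_system (seq A), UltraFilter U &
    forall a, U [set l | List.In a l].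
Proof.
pose B := [set P : set (seq A) |
  exists l0, forall l, (forall a, List.In a l0 -> List.In a l) -> P l].
have PB : ProperFilter B.
  split; first by case=> l0 /(_ l0); apply.
  split; first by exists [::].
    move=> P Q [l1 h1] [l2 h2]; exists (l1 ++ l2) => l hl; split.
      by apply: h1 => a al; apply: hl; apply: List.in_or_app; left.
    by apply: h2 => a al; apply: hl; apply: List.in_or_app; right.
  by move=> P Q PQ [l0 h]; exists l0 => l /h /PQ.
have [U [UU BU]] := ultraFilterLemma PB.
by exists U => // a; apply: BU; exists [:: a] => l; apply; left.
Qed.

Definition ultra_rel (I : Type) (U : set_system I) (M : I -> Type)
  (f : forall i, M i) : set (forall i, M i) := [set g | U [set i | f i = g i]].

(** Elements are equivalence classes, so that agreement modulo [U] becomes the equality of the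
    domain, by which [sat] interprets [Eq]. *)
Definition ultra_dom (I : Type) (U : set_system I) (M : I -> Type) :=
  {c : set (forall i, M i) | exists f, c = ultra_rel U f}.

Definition ultra_class (I : Type) (U : set_system I) (M : I -> Type)
    (f : forall i, M i) : ultra_dom U M :=
  exist _ (ultra_rel U f) (ex_intro _ f erefl).

Definition ultra_repr (I : Type) (U : set_system I) (M : I -> Type)
  (c : ultra_dom U M) : forall i, M i := sval (cid (svalP c)).

Lemma ultra_reprK I (U : set_system I) (M : I -> Type) :
  cancel (@ultra_repr I U M) (@ultra_class I U M).
Proof. by case=> c hc; apply: eq_exist; rewrite /ultra_repr; case: cid. Qed.

Lemma ultra_class_eq I (U : set_system I) (FU : Filter U) (M : I -> Type)
    (f g : forall i, M i) :
  ultra_class U f = ultra_class U g <-> U [set i | f i = g i].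
Proof.
split=> [/(congr1 sval) /= e|h].
  have : ultra_rel U g g by apply: filterE.
  by rewrite -e.
apply: eq_exist; apply/seteqP; split=> k /= fk.
  by apply: filterS (filterI h fk) => i [/= -> ->].
by apply: filterS (filterI h fk) => i [/= -> ->].
Qed.

Lemma ultra_class_repr I (U : set_system I) (FU : Filter U) (M : I -> Type)
    (f : forall i, M i) :
  U [set i | ultra_repr (ultra_class U f) i = f i].
Proof. by apply/(ultra_class_eq FU); rewrite ultra_reprK. Qed.

Definition ultraproduct C (I : Type) (U : set_system I) (M : I -> structure C) :
    structure C :=
  @Structure C (ultra_dom U (fun i => sdom (M i)))
    (ultra_class U (fun i => szero (M i)))
    (ultra_class U (fun i => sone (M i)))
    (fun a b => ultra_class U (fun i => sadd (ultra_repr a i) (ultra_repr b i)))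
    (fun a => ultra_class U (fun i => sopp (ultra_repr a i)))
    (fun a b => ultra_class U (fun i => smul (ultra_repr a i) (ultra_repr b i)))
    (fun c => ultra_class U (fun i => scst (M i) c)).

Lemma eval_ultraproduct C I (U : set_system I) (FU : Filter U)
    (M : I -> structure C) n (t : term C n) (e : 'I_n -> forall i, M i) :
  @eval C (ultraproduct U M) n (fun j => ultra_class U (e j)) t =
  ultra_class U (fun i => eval (e^~ i) t).
Proof.
have R t' := ultra_class_repr FU (fun i => eval (e^~ i) t').
elim: t => //= [t -> u ->|t ->|t -> u ->]; apply/(ultra_class_eq FU).
- by apply: filterS (filterI (R t) (R u)) => i [/= -> ->].
- by apply: filterS (R t) => i /= ->.
- by apply: filterS (filterI (R t) (R u)) => i [/= -> ->].
Qed.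

Lemma ultra_scons C I (U : set_system I) (M : I -> structure C) n
    (a : ultra_dom U (fun i => sdom (M i))) (e : 'I_n -> forall i, M i) :
  scons a (fun j => ultra_class U (e j)) =
  (fun j => ultra_class U (scons (ultra_repr a) e j)).
Proof.
by apply: funext => j; rewrite /scons; case: unlift => [k|] //=; rewrite ultra_reprK.
Qed.

Lemma scons_app C I (M : I -> structure C) n (a : forall i, M i) (e : 'I_n -> forall i, M i) i :
  (fun j => scons a e j i) = scons (a i) (e^~ i).
Proof. by apply: funext => j; rewrite /scons; case: unlift. Qed.

(** Negation and disjunction use that [U] is an ultrafilter; a quantifier is handled by choosing a
    witness, or a counterexample, in every factor at once. *)
Lemma Los C I (U : set_system I) (UU : UltraFilter U) (M : I -> structure C) n
    (f : formula C n) (e : 'I_n -> forall i, M i) :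
  @sat C (ultraproduct U M) n f (fun j => ultra_class U (e j)) <->
  U [set i | sat f (e^~ i)].
Proof.
have PU : ProperFilter U by case: UU.
have FU : Filter U by case: PU.
have UN P : U (~` P) <-> ~ U P.
  split=> [hN hP|hP].
    by apply: (@filter_not_empty _ U PU); apply: filterS (filterI hN hP) => i [].
  by case: (in_ultra_setVsetC P UU).
elim: f e => {n} [n t u|n f IH|n f IHf g IHg|n f IHf g IHg|n f IH|n f IH] e /=.
- by rewrite !eval_ultraproduct ultra_class_eq.
- by rewrite IH -UN.
- rewrite IHf IHg; split=> [[hf hg]|h]; first exact: filterI.
  by split; apply: filterS h => i [].
- rewrite IHf IHg; split=> [[]h|h]; [by apply: filterS h; left|by apply: filterS h; right|].
  apply: contrapT => /not_orP[/UN hf /UN hg].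
  apply: (@filter_not_empty _ U PU).
  by apply: filterS (filterI h (filterI hf hg)) => i [[]hi []].
- split=> [[a]|h].
    rewrite ultra_scons IH; apply: filterS => i /= hi.
    by exists (ultra_repr a i); move: hi; rewrite scons_app.
  (* The value [szero] serves at the indices without a witness, which [U] ignores. *)
  have [a ha] : exists a : forall i, M i, forall i,
      (exists b, sat f (scons b (e^~ i))) -> sat f (scons (a i) (e^~ i)).
    suff H i : {b : M i | (exists b, sat f (scons b (e^~ i))) -> sat f (scons b (e^~ i))}.
      by exists (fun i => sval (H i)) => i; exact: (svalP (H i)).
    by apply: cid; case: (pselect (exists b, sat f (scons b (e^~ i)))) => [[b hb]|hN];
      [exists b | exists (szero (M i)) => /hN].
  exists (ultra_class U a); rewrite ultra_scons IH.
  apply: filterS (filterI h (ultra_class_repr FU a)) => i [/= /ha hi er].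
  by rewrite scons_app er.
- split=> [h|h a].
    apply: contrapT => /UN hN.
    have [a ha] : exists a : forall i, M i, forall i,
      (exists b, ~ sat f (scons b (e^~ i))) -> ~ sat f (scons (a i) (e^~ i)).
      suff H i : {b : M i | (exists b, ~ sat f (scons b (e^~ i))) -> ~ sat f (scons b (e^~ i))}.
        by exists (fun i => sval (H i)) => i; exact: (svalP (H i)).
      by apply: cid; case: (pselect (exists b, ~ sat f (scons b (e^~ i)))) => [[b hb]|hn];
        [exists b | exists (szero (M i)) => /hn].
    have := h (ultra_class U a); rewrite ultra_scons IH => hU.
    apply: (@filter_not_empty _ U PU).
    apply: filterS (filterI hN (filterI hU (ultra_class_repr FU a))).
    move=> i [/= /existsNP /ha hi [hs er]].
    by apply: hi; move: hs => /=; rewrite scons_app er.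
  rewrite ultra_scons IH; apply: filterS h => i /= hi.
  by rewrite scons_app.
Qed.

Lemma models_ultraproduct C I (U : set_system I) (UU : UltraFilter U)
    (M : I -> structure C) (Sigma : set (sentence C)) :
  (forall i, models (M i) Sigma) -> models (ultraproduct U M) Sigma.
Proof.
move=> hM s Ss; have FU : Filter U by have [] := UU; case.
have E0 (N : Type) (e e' : 'I_0 -> N) : e = e' by apply: funext => -[].
rewrite (E0 _ (@noval _) (fun j => ultra_class U (@noval (forall i, M i) j))).
apply/(Los UU); apply: filterE => i /=.
by rewrite (E0 (M i) (fun j => @noval (forall i, M i) j i) (@noval (M i))); apply: hM.
Qed.

(** * Models of the theory of fields *)

(** A copy of the domain that remembers [H], so that the field structure derived from [H] can be
    attached to it. *)
Definition model_carrier C (M : structure C) (H : models M (@field_theory C)) : Type :=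
  sdom M.

HB.instance Definition _ C (M : structure C) (H : models M (@field_theory C)) :=
  gen_eqMixin (model_carrier H).
HB.instance Definition _ C (M : structure C) (H : models M (@field_theory C)) :=
  gen_choiceMixin (model_carrier H).

Lemma scons_ord0 (T : Type) (a : T) n (e : 'I_n -> T) (h : (0 < n.+1)%N) :
  scons a e (Ordinal h) = a.
Proof. by rewrite /scons (_ : Ordinal h = ord0) ?unlift_none //; apply: val_inj. Qed.

Lemma scons_ordS (T : Type) (a : T) n (e : 'I_n -> T) m (h : (m.+1 < n.+1)%N) :
  scons a e (Ordinal h) = e (@Ordinal n m h).
Proof.
rewrite /scons (_ : Ordinal h = lift ord0 (@Ordinal n m h)) ?liftK //.
exact: val_inj.
Qed.

(** The axioms only assert that inverses exist, so one is chosen; the default [a] makes the inverse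
    of [0] equal to [0]. *)
Definition model_inv C (M : structure C) (a : M) : M :=
  if pselect (exists b, smul a b = sone M) is left h then sval (cid h) else a.

Section ModelField.
Variables (C : Type) (M : structure C) (H : models M (@field_theory C)).

Local Notation T := (model_carrier H).
Local Notation add := (@sadd C M : T -> T -> T).
Local Notation opp := (@sopp C M : T -> T).
Local Notation mul := (@smul C M : T -> T -> T).
Local Notation zero := (szero M : T).
Local Notation one := (sone M : T).
Local Notation inv := (@model_inv C M : T -> T).
Let simp T := (@scons_ord0 T, @scons_ordS T).

Lemma model_addA : associative add.
Proof. by move=> x y z; have := H (ax_addA C) z y x; rewrite /= !simp. Qed.

Lemma model_addC : commutative add.
Proof. by move=> x y; have := H (ax_addC C) y x; rewrite /= !simp. Qed.

Lemma model_add0 : left_id zero add.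
Proof. by move=> x; have := H (ax_add0 C) x; rewrite model_addC /= !simp. Qed.

Lemma model_addN : left_inverse zero opp add.
Proof. by move=> x; have := H (ax_addN C) x; rewrite model_addC /= !simp. Qed.

Lemma model_mulA : associative mul.
Proof. by move=> x y z; have := H (ax_mulA C) z y x; rewrite /= !simp. Qed.

Lemma model_mulC : commutative mul.
Proof. by move=> x y; have := H (ax_mulC C) y x; rewrite /= !simp. Qed.

Lemma model_mul1 : left_id one mul.
Proof. by move=> x; have := H (ax_mul1 C) x; rewrite model_mulC /= !simp. Qed.

Lemma model_mulD : left_distributive mul add.
Proof.
move=> x y z; have := H (ax_mulD C) y x z.
by rewrite /= !simp !(model_mulC z).
Qed.

HB.instance Definition _ :=
  GRing.isZmodule.Build T model_addA model_addC model_add0 model_addN.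

Lemma model_one_neq0 : (one != zero).
Proof. by apply/eqP => e; apply: (H (ax_nontrivial C)). Qed.

HB.instance Definition _ := GRing.Zmodule_isComNzRing.Build T
  model_mulA model_mulC model_mul1 model_mulD model_one_neq0.

Lemma model_mulV (x : T) : x != 0 -> inv x * x = 1.
Proof.
move=> /eqP x0; rewrite mulrC /model_inv; case: pselect => [h|]; first by case: cid.
by case; have := H (ax_inv C) x; rewrite /= !simp => -[/x0 //|[b]]; rewrite !simp; exists b.
Qed.

Lemma model_inv0 : inv 0 = 0.
Proof.
rewrite /model_inv; case: pselect => //= -[b e]; exfalso.
by move/eqP: model_one_neq0; apply; rewrite -e; exact: (mul0r (b : T)).
Qed.

HB.instance Definition _ := GRing.ComNzRing_isField.Build T model_mulV model_inv0.

End ModelField.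

Lemma model_field_structure C (M : structure C) :
  models M (@field_theory C) ->
  exists (L : fieldType) (cL : C -> L), M = field_structure cL.
Proof.
move=> H; exists (model_carrier H), (scst M).
by case: M H.
Qed.


(** * Subfields and embeddings defined on them *)

Lemma subfield1 (K : fieldType) (F : set K) : subfield F -> F 1.
Proof. by case=> /set_mem. Qed.

Lemma subfieldB (K : fieldType) (F : set K) a b :
  subfield F -> F a -> F b -> F (a - b).
Proof. by case=> _ h _ Fa Fb; apply/set_mem/h; apply/mem_set. Qed.

Lemma subfield_div (K : fieldType) (F : set K) a b :
  subfield F -> F a -> F b -> F (a / b).
Proof. by case=> _ _ h Fa Fb; apply/set_mem/h; apply/mem_set. Qed.

Lemma subfield0 (K : fieldType) (F : set K) : subfield F -> F 0.
Proof. by move=> sF; rewrite -(subrr 1); apply: subfieldB => //; apply: subfield1. Qed.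

Lemma subfieldN (K : fieldType) (F : set K) a : subfield F -> F a -> F (- a).
Proof. by move=> sF Fa; rewrite -sub0r; apply: subfieldB => //; apply: subfield0. Qed.

Lemma subfieldD (K : fieldType) (F : set K) a b :
  subfield F -> F a -> F b -> F (a + b).
Proof. by move=> sF Fa Fb; rewrite -[b]opprK; apply: subfieldB => //; apply: subfieldN. Qed.

Lemma subfieldV (K : fieldType) (F : set K) a : subfield F -> F a -> F a^-1.
Proof. by move=> sF Fa; rewrite -[_^-1]mul1r; apply: subfield_div => //; apply: subfield1. Qed.

Lemma subfieldM (K : fieldType) (F : set K) a b :
  subfield F -> F a -> F b -> F (a * b).
Proof. by move=> sF Fa Fb; rewrite -[b]invrK; apply: subfield_div => //; apply: subfieldV. Qed.

Lemma mk_subfield (K : fieldType) (F : set K) :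
  F 1 -> (forall a b, F a -> F b -> F (a - b)) ->
  (forall a b, F a -> F b -> F (a / b)) -> subfield F.
Proof.
by move=> h1 hB hd; split=> [|a b /set_mem Fa /set_mem Fb|a b /set_mem Fa /set_mem Fb];
  apply/mem_set; [|exact: hB|exact: hd].
Qed.

Lemma gen_subfield_subfield (K : fieldType) (A : set K) : subfield (gen_subfield A).
Proof.
apply: mk_subfield => [F [sF _]|a b ha hb F [sF AF]|a b ha hb F [sF AF]].
- exact: subfield1.
- by apply: subfieldB => //; [apply: ha|apply: hb].
- by apply: subfield_div => //; [apply: ha|apply: hb].
Qed.

Lemma sub_gen_subfield (K : fieldType) (A : set K) : A `<=` gen_subfield A.
Proof. exact: sub_smallest. Qed.

Lemma gen_subfield_min (K : fieldType) (A F : set K) :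
  subfield F -> A `<=` F -> gen_subfield A `<=` F.
Proof. by move=> sF AF a /(_ F); apply. Qed.

Lemma embedding_eval C (K L : fieldType) (cK : C -> K) (cL : C -> L)
    (F : set K) (rho : K -> L) n (e : 'I_n -> K) :
  subfield F -> (forall c, F (cK c)) ->
  @embedding_on C (field_structure cK) (field_structure cL) F rho ->
  (forall i, F (e i)) -> forall t : term C n,
  F (@eval C (field_structure cK) n e t) /\
  @eval C (field_structure cL) n (fun i => rho (e i)) t =
    rho (@eval C (field_structure cK) n e t).
Proof.
move=> sF cF [/= _ r0 r1 rD rN rM rc] eF.
elim=> //= [||t [Ft ->] u [Fu ->]|t [Ft ->]|t [Ft ->] u [Fu ->]].
- by split; [exact: subfield0|].
- by split; [exact: subfield1|].
- by split; [exact: subfieldD|rewrite rD].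
- by split; [exact: subfieldN|rewrite rN].
- by split; [exact: subfieldM|rewrite rM].
Qed.

Lemma sat_embedding C (K L : fieldType) (cK : C -> K) (cL : C -> L)
    (F : set K) (rho : K -> L) n (e : 'I_n -> K) (f : formula C n) :
  subfield F -> (forall c, F (cK c)) ->
  @embedding_on C (field_structure cK) (field_structure cL) F rho ->
  (forall i, F (e i)) -> qf f ->
  @sat C (field_structure cK) n f e <->
  @sat C (field_structure cL) n f (fun i => rho (e i)).
Proof.
move=> sF cF er; elim: f e => {n} //= [n t u|n f IH|n f IHf g IHg|n f IHf g IHg] e eF.
- have [Ft ->] := embedding_eval sF cF er eF t.
  have [Fu ->] := embedding_eval sF cF er eF u => _.
  by split=> [->//|/(emb_inj er Ft Fu)].
- by move=> qff; rewrite IH.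
- by case/andP=> qff qfg; rewrite IHf // IHg.
- by case/andP=> qff qfg; rewrite IHf // IHg.
Qed.

(** * Compactness *)


(* The unknowns are indexed by an arbitrary type [V], so that compactness can
   produce a map defined on a whole field. *)
Definition condition C (V : Type) := {m : nat & (formula C m * ('I_m -> V))%type}.

Definition holds C V (M : structure C) (e : V -> M) (a : condition C V) : Prop :=
  sat (projT2 a).1 (fun i => e ((projT2 a).2 i)).

Lemma In_filter (T : Type) (P : set T) (a : T) l :
  List.In a [seq b <- l | `[< P b >]] <-> List.In a l /\ P a.
Proof.
elim: l => [|b l IHl] /=; first by split=> [|[]].
case: asboolP => hb /=; rewrite IHl; split.
- by move=> [<-|[al Pa]]; split=> //; [left|right].
- by move=> [[->|al] Pa]; [left|right].
- by move=> [al Pa]; split=> //; right.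
- by move=> [[<-|al] Pa].
Qed.

(** Choose for each finite list [l] a model of the part of [l] lying in [Phi], and take the
    ultraproduct along an ultrafilter for which almost every list contains any given condition. *)
Lemma compactness C (V : Type) (Sigma : set (sentence C)) (Phi : set (condition C V)) :
  (forall l : seq (condition C V), (forall a, List.In a l -> Phi a) ->
     exists2 M : structure C, models M Sigma &
     exists e : V -> M, forall a, List.In a l -> holds e a) ->
  exists2 M : structure C, models M Sigma &
    exists e : V -> M, forall a, Phi a -> holds e a.
Proof.
move=> H.
have W l : {M : structure C & {e : V -> M | models M Sigma /\
    forall a, List.In a l -> Phi a -> holds e a}}.
  have [|M hM /cid[e he]] := cid2 (H [seq a <- l | `[< Phi a >]] _).
    by move=> a /In_filter[].
  by exists M, e; split=> // a al ha; apply/he/In_filter.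
have [U UU Ua] := exists_ultra_seq (condition C V).
pose M l := projT1 (W l); pose e l := sval (projT2 (W l)).
have he l := svalP (projT2 (W l)).
exists (ultraproduct U M); first by apply: models_ultraproduct => // l; case: (he l).
exists (fun j => ultra_class U (fun l => e l j)) => a ha; apply/(Los UU).
have FU : Filter U by have [] := UU; case.
by apply: filterS (Ua a) => l /= al; apply: (he l).2 al ha.
Qed.

Lemma sat_ext C (M : structure C) n (f : formula C n) (e e' : 'I_n -> M) :
  (forall i, e i = e' i) -> sat f e -> sat f e'.
Proof. by move/funext->. Qed.

Lemma sat_And C (M : structure C) n (f g : formula C n) (e : 'I_n -> M) :
  sat (And f g) e <-> sat f e /\ sat g e.
Proof. by []. Qed.

Lemma In_mem (T : eqType) (a : T) s : a \in s <-> List.In a s.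
Proof.
elim: s => //= b s <-; rewrite inE; split=> [/predU1P[->|]|[->|->]]; rewrite ?eqxx ?orbT //;
  by [left|right].
Qed.

(* The variable standing for [a]; the value off the list is irrelevant. *)
Definition diag_var C (K : fieldType) n (ks : seq K) (a : K) : term C (size ks + n) :=
  if insub (index a ks) is Some i then Var (lshift n (i : 'I_(size ks))) else Zero.

Lemma eval_diag_var C (K : fieldType) (cK : C -> K) n (x : 'I_n -> K) ks a :
  a \in ks -> 
  @eval C (field_structure cK) _ (vcat (fun i : 'I_(size ks) => nth 0 ks i) x)
    (diag_var C n ks a) = a.
Proof.
move=> ka; rewrite /diag_var insubT ?index_mem // => h /=.
by rewrite vcat_lshift /= nth_index.
Qed.

(** Otherwise every finite part of the positive diagram of [K'] is consistent with [Sigma] and the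
    negation of [phi], and compactness gives an embedding of [K'] in a model along which [phi]
    fails. *)
Lemma positive_diagram C (Sigma : set (sentence C)) (K : fieldType) (cK : C -> K)
    n (x : 'I_n -> K) (phi : formula C n) (K' : set K) :
  @field_theory C `<=` Sigma -> subfield K' ->
  (forall c, K' (cK c)) -> (forall i, K' (x i)) ->
  (forall (L : fieldType) (cL : C -> L), models (field_structure cL) Sigma ->
     forall rho : K -> L,
     @embedding_on C (field_structure cK) (field_structure cL) K' rho ->
     @sat C (field_structure cL) n phi (fun i => rho (x i))) ->
  exists k (s : 'I_k -> K) (eta : formula C (k + n)),
    [/\ qf_pos eta, forall i, K' (s i),
        @sat C (field_structure cK) _ eta (vcat s x) &
        forall (L : fieldType) (cL : C -> L), models (field_structure cL) Sigma ->
        forall (s' : 'I_k -> L) (x' : 'I_n -> L),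
          @sat C (field_structure cL) _ eta (vcat s' x') ->
          @sat C (field_structure cL) n phi x'].
Proof.
move=> Sf sK' cK' xK' H; apply: contrapT => hN.
pose nphi : condition C K := existT _ n (Not phi, x).
pose diag (a : condition C K) := [/\ qf_pos (projT2 a).1,
  forall i, K' ((projT2 a).2 i) & @holds C K (field_structure cK) id a].
have [l hl|M hM [e he]] := @compactness C K Sigma [set a | diag a \/ a = nphi].
  pose l' := [seq a <- l | `[< diag a >]].
  (* [ks] lists the finitely many elements that matter: the [x i] and the parameters of the diagram
     conditions in [l]. *)
  pose ks := codom x ++ flatten [seq codom (projT2 a).2 | a <- l'].
  have xks i : x i \in ks by rewrite mem_cat codom_f.
  have lks a i : List.In a l' -> (projT2 a).2 i \in ks.
    rewrite mem_cat orbC /ks; elim: (l') => //= b l1 IH [->|/IH].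
      by rewrite mem_cat codom_f.
    by rewrite mem_cat => /orP[] ->; rewrite ?orbT.
  have ksK' b : b \in ks -> K' b.
    rewrite mem_cat => /orP[/codomP[i ->] //|].
    have : forall a, List.In a l' -> diag a by move=> a /In_filter[].
    elim: (l') => //= a l1 IH hd; rewrite mem_cat => /orP[/codomP[i ->]|/IH]; last first.
      by apply=> c cl; apply: hd; right.
    by have [] := hd a (or_introl erefl).
  pose v := diag_var C n ks.
  pose g (a : condition C K) := term_subst (fun i => v ((projT2 a).2 i)).
  (* The first conjunct ties each free variable to the variable standing for [x i]. *)
  pose eta := And
   (\big[@And C _/top C _]_(i <- enum 'I_n) Eq (Var (rshift _ i)) (v (x i)))
   (\big[@And C _/top C _]_(a <- l') map_terms (projT2 a).1 (g a)).
  have qeta : qf_pos eta.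
    rewrite /= qf_pos_bigAnd //=.
    have : forall a, List.In a l' -> diag a by move=> a /In_filter[].
    elim: (l') => [|a l1 IH] hd; first by rewrite big_nil.
    rewrite big_cons /= qf_pos_map_terms ?IH // => [b bl|]; first by apply: hd; right.
    by have [] := hd a (or_introl erefl).
  (* If this finite part had no model, [eta] would be the formula whose absence was assumed. *)
  apply: contrapT => hM; case: hN.
  exists (size ks), (fun i => nth 0 ks i), eta; split=> //.
  - by move=> i; apply/ksK'/mem_nth.
  - apply/sat_And; split; first by apply/sat_bigAnd => i _; rewrite /= vcat_rshift eval_diag_var.
    apply/sat_bigAnd => a al; have /In_filter[_ [qa aK' ha]] := al.
    apply/sat_subst; first exact: qf_pos_qf.
    by apply: sat_ext ha => i; rewrite eval_diag_var // lks.
  move=> L cL hL s' x' /sat_And[/sat_bigAnd hx /sat_bigAnd he]; apply: contrapT => nph.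
  case: hM; exists (field_structure cL) => //.
  exists (fun a => @eval C (field_structure cL) _ (vcat s' x') (v a)) => a al.
  case: (hl a al) => [da|ea].
    have := he a ((In_filter diag a l).2 (conj al da)).
    by move/sat_subst; apply; case: da => q _ _; exact: qf_pos_qf.
  rewrite ea /holds /= => h; apply: nph; apply: sat_ext h => i.
  have := hx i; rewrite /= vcat_rshift => -> //.
  by apply/In_mem; rewrite mem_enum.
have [L [cL eM]] := model_field_structure (fun s hs => hM s (Sf s hs)).
move: hM e he; rewrite {M}eM => hM e he.
have ph : ~ @sat C (field_structure cL) n phi (fun i => e (x i)).
  exact: (he nphi (or_intror erefl)).
apply: ph; apply: H => //.
have P m (f : formula C m) (j : 'I_m -> K) : qf_pos f -> (forall i, K' (j i)) ->
    @sat C (field_structure cK) m f j -> @sat C (field_structure cL) m f (fun i => e (j i)).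
  by move=> qf_f jK fj; apply: (he (existT _ m (f, j))); left.
pose v0 : term C 3 := Var (@Ordinal 3 0 isT).
pose v1 : term C 3 := Var (@Ordinal 3 1 isT).
pose v2 : term C 3 := Var (@Ordinal 3 2 isT).
pose j a b c (i : 'I_3) : K := nth 0 [:: a; b; c] i.
have jK a b c : K' a -> K' b -> K' c -> forall i, K' (j a b c i).
  by move=> ? ? ? [[|[|[|]]]].
have K0 := subfield0 sK'; have K1 := subfield1 sK'.
have e0 : e 0 = 0 by have := P _ (Eq v0 Zero) (j 0 0 0) isT (jK _ _ _ K0 K0 K0) erefl.
have e1 : e 1 = 1 by have := P _ (Eq v0 One) (j 1 0 0) isT (jK _ _ _ K1 K0 K0) erefl.
have eD a b : K' a -> K' b -> e (a + b) = e a + e b.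
  move=> Ka Kb; exact: (P _ (Eq v0 (Add v1 v2)) (j (a + b) a b) isT
    (jK _ _ _ (subfieldD sK' Ka Kb) Ka Kb) erefl).
have eM a b : K' a -> K' b -> e (a * b) = e a * e b.
  move=> Ka Kb; exact: (P _ (Eq v0 (Mul v1 v2)) (j (a * b) a b) isT
    (jK _ _ _ (subfieldM sK' Ka Kb) Ka Kb) erefl).
have eN a : K' a -> e (- a) = - e a.
  move=> Ka; exact: (P _ (Eq v0 (Opp v1)) (j (- a) a a) isT
    (jK _ _ _ (subfieldN sK' Ka) Ka Ka) erefl).
split=> //=.
(* The positive diagram has no inequations; injectivity comes from the inverse of [a - b], whose
   product with [a - b] is sent to [1]. *)
- move=> a b Ka Kb eab; apply/eqP; rewrite -subr_eq0; apply/negPn/negP => ab0.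
  have Kab := subfieldB sK' Ka Kb.
  have := eM _ _ Kab (subfieldV sK' Kab).
  rewrite divff // e1 eD ?eN ?eab ?subrr ?mul0r //; last exact: subfieldN.
  by move/eqP; rewrite oner_eq0.
- by move=> c; exact: (P _ (Eq v0 (Cst c)) (j (cK c) 0 0) isT (jK _ _ _ (cK' c) K0 K0) erefl).
Qed.


(** * Subfields as types *)

Definition subfield_pred (K : fieldType) (F : set K) (sF : subfield F) : {pred K} :=
  mem F.

HB.instance Definition _ (K : fieldType) (F : set K) (sF : subfield F) :=
  GRing.isDivringClosed.Build K (subfield_pred sF) sF.

Record subfield_type (K : fieldType) (F : set K) (sF : subfield F) :=
  SubfieldElt { subfield_val : K; _ : subfield_val \in subfield_pred sF }.

HB.instance Definition _ (K : fieldType) (F : set K) (sF : subfield F) :=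
  [isSub for @subfield_val K F sF].
HB.instance Definition _ (K : fieldType) (F : set K) (sF : subfield F) :=
  [Choice of subfield_type sF by <:].
HB.instance Definition _ (K : fieldType) (F : set K) (sF : subfield F) :=
  [SubChoice_isSubIntegralDomain of subfield_type sF by <:].
HB.instance Definition _ (K : fieldType) (F : set K) (sF : subfield F) :=
  [SubIntegralDomain_isSubField of subfield_type sF by <:].

Definition subfield_inj (K : fieldType) (F : set K) (sF : subfield F) :
  {rmorphism subfield_type sF -> K} := val.

Lemma subfield_injP (K : fieldType) (F : set K) (sF : subfield F) a :
  F (subfield_inj sF a).
Proof. by case: a => a /= /set_mem. Qed.

Lemma subfield_inj_onto (K : fieldType) (F : set K) (sF : subfield F) a :
  F a -> exists b, subfield_inj sF b = a.
Proof. by move=> /mem_set Fa; exists (SubfieldElt (sF := sF) Fa). Qed.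

Lemma subfield_poly (K : fieldType) (F : set K) (sF : subfield F) (p : {poly K}) :
  (forall i, F p`_i) -> exists q, map_poly (subfield_inj sF) q = p.
Proof.
move=> pF; exists (\poly_(i < size p) insubd 0 p`_i); apply/polyP => i.
rewrite coef_map coef_poly; case: ltnP => [ip|hi]; last by rewrite [RHS]nth_default.
by rewrite /= insubdK //; apply/mem_set/pF.
Qed.

Lemma algebraic_overP (K : fieldType) (F : set K) (sF : subfield F) a :
  algebraic_over F a <-> algebraicOver (subfield_inj sF) a.
Proof.
split=> [[p [p0 /(subfield_poly sF)[q pq] pa]]|[q q0 qa]].
  exists q; last by rewrite pq.
  by apply: contraNneq p0 => q0; rewrite -pq q0 map_poly0.
exists (map_poly (subfield_inj sF) q); split=> //; first by rewrite map_poly_eq0.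
by move=> i; rewrite coef_map; exact: subfield_injP.
Qed.

(** * Algebraic elements and simple extensions *)

Lemma algebraic_root (F K : fieldType) (iota : {rmorphism F -> K}) (p : {poly K}) a :
  p != 0 -> root p a -> (forall i, algebraicOver iota p`_i) -> algebraicOver iota a.
Proof.
move=> p0 pa ip; apply/integral_algebraic; apply: integral_root p0 pa _.
by move=> b /(nthP 0)[i _ <-]; apply/integral_algebraic.
Qed.

Lemma subfield_algebraic (F K : fieldType) (iota : {rmorphism F -> K}) :
  subfield [set a | algebraicOver iota a].
Proof.
apply: mk_subfield => /=; first exact: algebraic1.
  by move=> a b; exact: algebraic_sub.
by move=> a b; exact: algebraic_div.
Qed.

(** The ring [F[z]], which is the field [F(z)] once [z] is algebraic. *)
Definition adjoin (F K : fieldType) (iota : {rmorphism F -> K}) (z : K) : set K :=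
  [set b | exists q : {poly F}, (map_poly iota q).[z] = b].

Section Adjoin.
Variables (F K : fieldType) (iota : {rmorphism F -> K}).
Implicit Types a b z : K.

Lemma adjoin_base z c : adjoin iota z (iota c).
Proof. by exists c%:P; rewrite map_polyC hornerC. Qed.

Lemma adjoin_gen z : adjoin iota z z.
Proof. by exists 'X; rewrite map_polyX hornerX. Qed.

Lemma adjoin_algebraic z b :
  algebraicOver iota z -> adjoin iota z b -> algebraicOver iota b.
Proof.
move=> /integral_algebraic az [q <-]; apply/integral_algebraic/integral_horner => //.
by move=> c /(nthP 0)[i _ <-]; rewrite coef_map; exact: integral_id.
Qed.

Lemma adjoin_trans z b c : adjoin iota z b -> adjoin iota b c -> adjoin iota z c.
Proof.
move=> [q qz] [r rb]; exists (r \Po q).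
by rewrite map_comp_poly horner_comp qz.
Qed.

Lemma adjoin_exp z b k : adjoin iota z b -> adjoin iota z (b ^+ k).
Proof. by case=> q <-; exists (q ^+ k); rewrite rmorphXn /= horner_exp. Qed.

(** Divide an equation of [b] by ['X] until its constant term [c] is nonzero; it then reads
    [r(b) * b = - c]. *)
Lemma algebraic_inv_adjoin b :
  b != 0 -> algebraicOver iota b -> adjoin iota b b^-1.
Proof.
move=> b0 [r]; elim/poly_ind: r => [|r c IHr]; first by rewrite eqxx.
rewrite rmorphD rmorphM /= map_polyX map_polyC rootE !hornerE /=.
have [->|c0 _] := eqVneq c 0.
  move=> rX0; rewrite rmorph0 addr0 mulf_eq0 (negPf b0) orbF => rb; apply: IHr => //.
  by apply: contraNneq rX0 => ->; rewrite mul0r polyC0 addr0.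
rewrite addr_eq0 => /eqP rb; exists ((- c^-1) *: r).
rewrite map_polyZ hornerZ rmorphN fmorphV /=; apply: (mulIf b0).
rewrite mulVf // -mulrA rb mulrN mulNr opprK mulVf //.
by rewrite fmorph_eq0.
Qed.

Lemma subfield_adjoin z : algebraicOver iota z -> subfield (adjoin iota z).
Proof.
move=> az; apply: mk_subfield => [|a b [p <-] [q <-]|a b [p <-] hb].
- by exists 1; rewrite rmorph1 hornerC.
- by exists (p - q); rewrite rmorphB /= hornerD hornerN.
have [->|b0] := eqVneq b 0; first by exists 0; rewrite invr0 mulr0 rmorph0 horner0.
have /(adjoin_trans hb)[r <-] := algebraic_inv_adjoin b0 (adjoin_algebraic az hb).
by exists (p * r); rewrite rmorphM /= hornerM.
Qed.

End Adjoin.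

(** * Separability and primitive elements *)

Section PrimitiveElements.
Variables (F K : fieldType) (iota : {rmorphism F -> K}).

(** Strong induction on the size of [f]. An inseparable [f] either has zero derivative, and then [g]
    and [s ^+ P] replace [f] and [s], or has a proper factor. *)
Lemma separable_power_aux (P : nat) :
  (forall f : {poly F}, (1 < size f)%N -> f^`() = 0 ->
     exists g : {poly F}, [/\ g != 0, (size g < size f)%N & f = g \Po 'X^P]) ->
  forall (f : {poly F}) (s : K), f != 0 -> root (map_poly iota f) s ->
  exists m q, separable_poly q /\ root (map_poly iota q) (s ^+ (P ^ m)).
Proof.
move=> HP f; have [k] := ubnP (size f).
elim: k f => // k IHk f; rewrite ltnS => fk s f0 fs.
have [sf|nsf] := boolP (separable_poly f).
  by exists 0%N, f; rewrite expn0 expr1.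
have f1 : (1 < size f)%N.
  by rewrite -(size_map_poly iota); apply: root_size_gt1 fs; rewrite map_poly_eq0.
have [df0|df0] := eqVneq f^`() 0.
  have [g [g0 gf ef]] := HP f f1 df0.
  have gs : root (map_poly iota g) (s ^+ P).
    by move: fs; rewrite ef map_comp_poly map_polyXn root_comp hornerXn.
  have [m [q [sq qs]]] := IHk g (leq_trans gf fk) _ g0 gs.
  by exists m.+1, q; split=> //; rewrite expnS exprM.
(* [s] is a root of [d] or of [f %/ d], and both are smaller than [f]. *)
pose d := gcdp f f^`().
have d0 : d != 0 by rewrite gcdp_eq0 (negPf f0).
have d1 : (1 < size d)%N.
  move: nsf; rewrite unlock /coprimep -/d; case: (size d) (size_poly_gt0 d) => [|[|n]] //.
  by rewrite d0.
have df : (size d < size f)%N.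
  by apply: leq_ltn_trans (lt_size_deriv f0); apply: dvdp_leq => //; exact: dvdp_gcdr.
have ef : f = f %/ d * d by rewrite divpK // dvdp_gcdl.
have q0 : f %/ d != 0 by apply: contraNneq f0 => q0; rewrite ef q0 mul0r.
move: fs; rewrite {1}ef rmorphM rootM => /orP[] rs.
  apply: (IHk _ _ _ q0 rs); apply: leq_trans fk; rewrite size_divp //.
  by rewrite ltn_subrL size_poly_gt0 f0 andbT; case: (size d) d1 => [|[]].
exact: (IHk _ (leq_trans df fk) _ d0 rs).
Qed.

Lemma separable_power (p : nat) (f : {poly F}) (s : K) :
  p \in [pchar F] -> f != 0 -> root (map_poly iota f) s ->
  exists m q, separable_poly q /\ root (map_poly iota q) (s ^+ (p ^ m)).
Proof.
move=> pF; apply: separable_power_aux => {s}f f1 df0.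
have pp := pcharf_prime pF; have p0 := prime_gt0 pp.
pose g := \poly_(i < size f) f`_(i * p).
have ef : f = g \Po 'X^p.
  apply/polyP => i; rewrite coef_comp_poly_Xn //; case: ifP => [pi|npi].
    rewrite coef_poly divnK //; case: ltnP => // fi; rewrite nth_default //.
    by apply: leq_trans fi _; exact: leq_div.
  case: i npi => [|i npi]; first by rewrite dvdn0.
  move/polyP/(_ i): df0; rewrite coef_deriv coef0 -mulr_natr => /eqP.
  by rewrite mulf_eq0 -(dvdn_pcharf pF) npi orbF => /eqP.
have f0 : f != 0 by rewrite -size_poly_gt0 ltnW.
have g0 : g != 0 by apply: contraNneq f0 => g0; rewrite ef g0 comp_poly0.
exists g; split=> //.
have := size_comp_poly g 'X^p; rewrite -ef size_polyXn /= => sf.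
rewrite -(prednK (ltnW f1)) -(prednK (_ : 0 < size g)%N) ?size_poly_gt0 // ltnS sf.
rewrite ltn_Pmulr ?prime_gt1 //.
by move: f1; rewrite -ltn_predRL sf; case: (size g).-1.
Qed.

(** In characteristic 0 a nonconstant polynomial has nonzero derivative, so the exponent [P] may be
    taken to be 1. *)
Lemma separable_pchar0 (f : {poly F}) (s : K) :
  [pchar F] =i pred0 -> f != 0 -> root (map_poly iota f) s ->
  exists2 q, separable_poly q & root (map_poly iota q) s.
Proof.
move=> F0 f0 fs; have [|m [q [sq qs]]] := @separable_power_aux 1 _ f s f0 fs; last first.
  by exists q; rewrite // -[s]expr1 -(exp1n m).
move=> {f0 fs}f f1 df0.
move/polyP/(_ (size f).-2): df0; rewrite coef_deriv coef0 -mulr_natr => /eqP.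
rewrite mulf_eq0 ((pcharf0P F).1 F0) orbF prednK ?ltn_predRL //.
by rewrite -lead_coefE lead_coef_eq0 -size_poly_eq0; case: (size f) f1.
Qed.

(** The form in which primitive elements use that [F] is infinite. *)
Definition large := forall r : {poly K}, r != 0 -> exists c, ~~ root r (iota c).

(** The [y] are adjoined one by one, starting from [w]. At each stage only the new element has to be
    separable, so [w] may be inseparable. *)
Lemma primitive_element_seq (w : K) (ys : seq K) :
  large -> algebraicOver iota w ->
  (forall y, y \in ys ->
     exists2 q, separable_poly q & root (map_poly iota q) y) ->
  exists2 z, algebraicOver iota z &
    adjoin iota z w /\ forall y, y \in ys -> adjoin iota z y.
Proof.
move=> inf aw; elim: ys => [|y ys IHys] hys.
  by exists w => //; split=> //; exact: adjoin_gen.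
have [|z az [zw zys]] := IHys; first by move=> b bys; apply: hys; rewrite inE bys orbT.
have [q sq qy] := hys y (mem_head _ _).
have [p p0 pz] := az.
(* Away from the roots of [r], the element [iota c * y - z] generates both [y] and [z]. *)
have [r r0 hr] := large_field_PET p0 pz qy sq.
have [c /hr /= [hz hy]] := inf r r0.
exists (iota c * y - z).
  apply: algebraic_sub => //; apply: algebraic_mul; first exact: algebraic_id.
  by exists q => //; exact: separable_poly_neq0.
split; first exact: adjoin_trans hz zw.
by move=> b; rewrite inE => /predU1P[->//|/zys]; exact: adjoin_trans hz.
Qed.

End PrimitiveElements.


(** * Algebraic extensions of finite fields *)

Section RootsOfUnity.
Variable K : fieldType.
Implicit Types a b z : K.

Definition torsion a := exists2 k, (0 < k)%N & a ^+ k = 1.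

(** The products of powers of [a] and [b] form a finite multiplicative group, and such a group in a
    field is cyclic. *)
Lemma torsion_join a b : torsion a -> torsion b ->
  exists2 z, torsion z & exists i j, a = z ^+ i /\ b = z ^+ j.
Proof.
move=> [n n0 an] [m m0 bm].
pose rs := undup [seq a ^+ i * b ^+ j | i <- index_iota 0 n, j <- index_iota 0 m].
have rsP g : reflect (exists i j, g = a ^+ i * b ^+ j) (g \in rs).
  rewrite mem_undup; apply: (iffP allpairsP) => [[[i j] /= [_ _ ->]]|[i [j ->]]].
    by exists i, j.
  exists (i %% n, j %% m)%N; rewrite /= !mem_index_iota !ltn_pmod //; split=> //.
  by rewrite !expr_mod.
have a0 : a != 0 by apply: contra_eq_neq an => ->; rewrite expr0n gtn_eqF // eq_sym oner_eq0.
have b0 : b != 0 by apply: contra_eq_neq bm => ->; rewrite expr0n gtn_eqF // eq_sym oner_eq0.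
have rs0 g : g \in rs -> g != 0.
  by case/rsP=> i [j ->]; rewrite mulf_neq0 ?expf_neq0.
have Urs : uniq rs by exact: undup_uniq.
have rs1 : 1 \in rs by apply/rsP; exists 0%N, 0%N; rewrite mulr1.
have N0 : (0 < size rs)%N by case: (rs) rs1.
have rsN g : g \in rs -> g ^+ size rs = 1.
  (* Multiplication by [g] permutes [rs]; comparing the products of all elements gives
     [g ^+ size rs = 1]. *)
  move=> grs; have inj : injective (fun h => g * h) by apply: mulfI; exact: rs0.
  have pe : perm_eq [seq g * h | h <- rs] rs.
    have Ug : uniq [seq g * h | h <- rs] by rewrite map_inj_uniq.
    apply: uniq_perm => //; apply: (uniq_min_size Ug _ _).2; last by rewrite size_map.
    move=> _ /mapP[h hrs ->]; case/rsP: grs => i [j ->]; case/rsP: hrs => i' [j' ->].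
    by apply/rsP; exists (i + i')%N, (j + j')%N; rewrite mulrACA -!exprD.
  have := perm_big _ pe (op := *%R) (P := xpredT) (F := id) (x := 1).
  rewrite big_map big_split /= big_const_seq count_predT iter_mulr mulr1.
  have nz : \prod_(h <- rs) h != 0.
    by rewrite prodf_seq_neq0; apply/allP => h hrs; rewrite /= rs0.
  by move=> e; apply: (mulIf nz); rewrite mul1r.
have un : all (size rs).-unity_root rs.
  by apply/allP => g grs; rewrite unity_rootE rsN.
have /hasP[z zrs pz] := has_prim_root N0 un Urs (leqnn _).
exists z; first by exists (size rs) => //; exact: prim_expr_order.
have [] : a \in rs /\ b \in rs.
  by split; apply/rsP; [exists 1%N, 0%N|exists 0%N, 1%N]; rewrite expr0 expr1 ?mulr1 ?mul1r.
move=> /rsN /(prim_rootP pz)[i ai] /rsN /(prim_rootP pz)[j bj].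
by exists i, j.
Qed.

Lemma torsion_join_seq (ss : seq K) : (forall s, s \in ss -> s != 0 -> torsion s) ->
  exists2 z, torsion z & forall s, s \in ss -> s = 0 \/ exists i, s = z ^+ i.
Proof.
elim: ss => [|s ss IHss] hs; first by exists 1 => //; exists 1%N.
have [|z tz zss] := IHss; first by move=> b bs; apply: hs; rewrite inE bs orbT.
have [s0|s0] := eqVneq s 0.
  by exists z => // b; rewrite inE => /predU1P[->|/zss //]; left.
have [y ty [i [j [-> ey]]]] := torsion_join (hs s (mem_head _ _) s0) tz.
exists y => // b; rewrite inE => /predU1P[->|/zss[->|[k ->]]]; [by right; exists i|by left|].
by right; exists (j * k)%N; rewrite ey exprM.
Qed.

End RootsOfUnity.

Section FiniteBase.
Variables (F K : fieldType) (iota : {rmorphism F -> K}).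

(** Otherwise [F] has lists of distinct elements of any length, and one of length [size r] is too
    long to consist of roots of [r]. *)
Lemma not_large_finite : ~ large iota -> exists fs : seq F, forall c, c \in fs.
Proof.
move=> /existsNP[r /not_implyP[r0 /forallNP hr]]; apply: contrapT => /forallNP hN.
have H k : exists2 fs : seq F, uniq fs & size fs = k.
  elim: k => [|k [fs ufs sfs]]; first by exists [::].
  have /existsNP[c /negP cfs] := hN fs.
  by exists (c :: fs); rewrite /= ?cfs ?sfs.
have [fs ufs sfs] := H (size r).
have ar : all (root r) (map iota fs).
  by apply/allP => _ /mapP[c _ ->]; exact/negPn/negP/hr.
have := max_poly_roots r0 ar; rewrite map_inj_uniq; last exact: fmorph_inj.
by rewrite ufs size_map sfs ltnn => /(_ isT).
Qed.

Lemma finite_polys (fs : seq F) (D : nat) : (forall c, c \in fs) ->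
  exists ps : seq {poly F}, forall q : {poly F}, (size q <= D)%N -> q \in ps.
Proof.
move=> hfs; elim: D => [|D [ps hps]].
  by exists [:: 0] => q; rewrite leqn0 size_poly_eq0 => /eqP->; rewrite inE.
exists (0 :: [seq q * 'X + c%:P | q <- ps, c <- fs]); elim/poly_ind => [|q c _].
  by rewrite inE eqxx.
rewrite size_MXaddC; case: ifP => [/andP[/eqP-> /eqP->] _|_].
  by rewrite mul0r add0r inE eqxx.
rewrite ltnS => /hps qps; rewrite inE; apply/orP; right.
by apply/allpairsP; exists (q, c); split.
Qed.

(** The powers of [s] are values at [s] of remainders modulo [p], of which there are finitely many,
    so two of them agree. *)
Lemma finite_base_torsion (fs : seq F) (s : K) : (forall c, c \in fs) ->
  algebraicOver iota s -> s != 0 -> torsion s.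
Proof.
move=> hfs [p p0 ps] s0; have [qs hqs] := finite_polys (size p) hfs.
pose V := [seq (map_poly iota q).[s] | q <- qs].
have sV i : s ^+ i \in V.
  apply/mapP; exists ('X^i %% p); first by apply: hqs; rewrite ltnW // ltn_modp.
  have := congr1 (fun q => (map_poly iota q).[s]) (divp_eq 'X^i p).
  by rewrite map_polyXn hornerXn rmorphD rmorphM /= hornerD hornerM (rootP ps) mulr0 add0r.
have : ~~ uniq (mkseq (fun i => s ^+ i) (size V).+1).
  apply/negP => U; have := uniq_leq_size U (s2 := V).
  rewrite size_mkseq ltnn => H; suff : false by [].
  by apply: H => _ /mapP[i _ ->].
case/(uniqPn 0)=> i [j [ij]]; rewrite size_mkseq => jV.
rewrite !nth_mkseq ?(ltn_trans ij) // -(subnK (ltnW ij)) exprD => e.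
exists (j - i)%N; first by rewrite subn_gt0.
by apply: (mulIf (expf_neq0 i s0)); rewrite mul1r -e.
Qed.

Lemma primitive_element_finite (ss : seq K) :
  ~ large iota -> (forall s, s \in ss -> algebraicOver iota s) ->
  exists2 z, algebraicOver iota z & forall s, s \in ss -> adjoin iota z s.
Proof.
move=> /not_large_finite[fs hfs] hss.
have [s sss s0|z [k k0 zk] zss] := @torsion_join_seq K ss.
  exact: (finite_base_torsion hfs (hss s sss) s0).
exists z.
  exists ('X^k - 1); first by rewrite monic_neq0 // monicXnsubC.
  by rewrite rmorphB rmorph1 /= map_polyXn rootE !hornerE zk subrr.
move=> s /zss[->|[i ->]]; first by exists 0; rewrite rmorph0 horner0.
by apply/adjoin_exp/adjoin_gen.
Qed.

End FiniteBase.


(** * Reduction to simple algebraic extensions *)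

Lemma natinf_Some (S : set nat) r :
  natinf S = Some r -> S r /\ forall k, S k -> (r <= k)%N.
Proof.
rewrite /natinf; case: pselect => // exS [<-]; case: ex_minnP => m /asboolP Sm hm.
by split=> // k Sk; apply/hm/asboolP.
Qed.

Lemma natinf_None (S : set nat) : natinf S = None -> forall k, ~ S k.
Proof.
rewrite /natinf; case: pselect => // nS _ k Sk; apply: nS.
by exists k; apply/asboolP.
Qed.

Lemma rk_ex_le1 C (T : set (sentence C)) n (f : formula C n) :
  natinf_le (rk_ex T f) 1 ->
  exists2 chi : formula C (1 + n), qf chi & equiv_mod T f (exs chi).
Proof.
rewrite /rk_ex; case E: natinf => [r|] //=.
have [[chi qchi Hchi] _] := natinf_Some E.
case: r chi qchi Hchi {E} => [|[|//]] chi qchi Hchi _; last by exists chi.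
(* Rank 0 is brought to one quantifier by a dummy variable. *)
exists (map_terms (chi : formula C n) (term_subst (fun i => Var (rshift 1 i)))).
  exact: qf_map_terms.
move=> M hM e; rewrite Hchi //; split=> [h|/(@sat_exs _ _ _ 1)[v]].
  apply/(@sat_exs _ _ _ 1); exists (fun=> szero M); apply/sat_subst => //.
  by apply: sat_ext h => i /=; rewrite vcat_rshift.
move/(sat_subst _ _ qchi).1; apply: sat_ext => i /=.
by rewrite vcat_rshift.
Qed.

Section FieldEval.
Variables (C : Type) (K : fieldType) (cK : C -> K).
Local Notation ev := (@eval C (field_structure cK) _).

Lemma eval_pow_term n (e : 'I_n -> K) t m : ev e (pow_term t m) = ev e t ^+ m.
Proof. by elim: m => //= m IHm; rewrite exprS -IHm. Qed.

Lemma eval_nat_term n (e : 'I_n -> K) k : ev e (nat_term C n k) = k%:R.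
Proof. by elim: k => //= k IHk; rewrite -natr1 addrC -IHk. Qed.

Lemma sat_pi_formula n m (u : 'I_n -> K) :
  @sat C (field_structure cK) n (pi_formula C n m) u <->
  exists s : 'I_n -> K, forall i, u i = s i ^+ m.
Proof.
rewrite sat_exs; split=> -[s hs]; exists s.
  move=> i; move/sat_bigAnd: hs => /(_ i) /=.
  rewrite eval_pow_term /= vcat_lshift vcat_rshift; apply.
  by apply/In_mem; rewrite mem_index_enum.
by apply/sat_bigAnd => i _ /=; rewrite eval_pow_term /= vcat_lshift vcat_rshift.
Qed.

Lemma models_theory_char Sigma p : p%:R = 0 :> K ->
  models (field_structure cK) Sigma -> models (field_structure cK) (theory_char Sigma p).
Proof.
move=> p0 hS s [/hS //|->] /=.
by rewrite eval_nat_term.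
Qed.

End FieldEval.

(* The twist of a term by the [q]-power Frobenius map. *)
Fixpoint pow_csts C n (q : nat) (t : term C n) : term C n :=
  match t with
  | Var i => Var i
  | Cst c => pow_term (Cst c) q
  | Zero => Zero
  | One => One
  | Add t u => Add (pow_csts q t) (pow_csts q u)
  | Opp t => Opp (pow_csts q t)
  | Mul t u => Mul (pow_csts q t) (pow_csts q u)
  end.

(** In characteristic [p], raising to the power [p ^ m] is an injective ring endomorphism; the
    constants have to be raised along with the variables. *)
Lemma sat_pow_csts C (K : fieldType) (cK : C -> K) p m n (f : formula C n)
    (e : 'I_n -> K) : p \in [pchar K] -> qf f ->
  @sat C (field_structure cK) n (map_terms f (pow_csts (p ^ m)))
    (fun i => e i ^+ (p ^ m)) <-> @sat C (field_structure cK) n f e.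
Proof.
move=> pK; set q := (p ^ m)%N.
have qK : [pchar K].-nat q.
  rewrite pnatX; apply/orP; left; rewrite (eq_pnat _ (pcharf_eq pK)).
  by rewrite pnat_id // (pcharf_prime pK).
have q0 : (0 < q)%N by rewrite expn_gt0 prime_gt0 // (pcharf_prime pK).
have E t : @eval C (field_structure cK) n (fun i => e i ^+ q) (pow_csts q t) =
    @eval C (field_structure cK) n e t ^+ q.
  elim: t => //=.
  - by move=> c; rewrite eval_pow_term.
  - by rewrite expr0n gtn_eqF.
  - by rewrite expr1n.
  - by move=> t -> u ->; rewrite exprDn_pchar.
  - by move=> t ->; rewrite exprNn_pchar.
  - by move=> t -> u ->; rewrite exprMn.
apply: sat_map_terms => t u; rewrite !E; split=> [/eqP|->//].
rewrite -subr_eq0 -exprNn_pchar // -exprDn_pchar // expf_eq0 q0 /= subr_eq0.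
by move/eqP.
Qed.

Fixpoint term_poly C (K : fieldType) (cK : C -> K) k (u : 'I_k -> K)
    (t : term C (1 + k)) : {poly K} :=
  match t with
  | Var i => if split i is inr j then (u j)%:P else 'X
  | Cst c => (cK c)%:P
  | Zero => 0
  | One => 1
  | Add t t' => term_poly cK u t + term_poly cK u t'
  | Opp t => - term_poly cK u t
  | Mul t t' => term_poly cK u t * term_poly cK u t'
  end.

Lemma horner_term_poly C (K : fieldType) (cK : C -> K) k (u : 'I_k -> K) t w :
  (term_poly cK u t).[w] = @eval C (field_structure cK) _ (vcat (fun _ : 'I_1 => w) u) t.
Proof.
elim: t => //= [i|c||| t <- t' <-|t <-|t <- t' <-]; rewrite ?hornerE //.
by rewrite /vcat; case: split => [j|j]; rewrite hornerE.
Qed.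

Lemma sat_generic C (K : fieldType) (cK : C -> K) n (f : formula C n)
    (e : K -> 'I_n -> K) w :
  (forall t t' : term C n, exists2 r : {poly K}, r != 0 & forall w', ~~ root r w' ->
    (@eval C (field_structure cK) _ (e w) t = @eval C (field_structure cK) _ (e w) t' <->
     @eval C (field_structure cK) _ (e w') t = @eval C (field_structure cK) _ (e w') t')) ->
  qf f -> exists2 r : {poly K}, r != 0 & forall w', ~~ root r w' ->
    (@sat C (field_structure cK) _ f (e w) <-> @sat C (field_structure cK) _ f (e w')).
Proof.
elim: f e => {n} //= [n f IH|n f IHf g IHg|n f IHf g IHg] e H.
- by move=> /(IH e H)[r r0 hr]; exists r => // w' /hr ->.
- case/andP=> /(IHf e H)[r r0 hr] /(IHg e H)[r' r'0 hr'].
  exists (r * r'); first exact: mulf_neq0.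
  by move=> w'; rewrite rootM negb_or => /andP[/hr-> /hr'->].
- case/andP=> /(IHf e H)[r r0 hr] /(IHg e H)[r' r'0 hr'].
  exists (r * r'); first exact: mulf_neq0.
  by move=> w'; rewrite rootM negb_or => /andP[/hr-> /hr'->].
Qed.

(* At a transcendental point an equation either holds identically or fails
   outside the finitely many roots of a nonzero polynomial. *)
Lemma sat_transcendental C (K F : fieldType) (cK : C -> K) (iota : {rmorphism F -> K})
    k (u : 'I_k -> K) w (chi : formula C (1 + k)) :
  (forall c, algebraicOver iota (cK c)) -> (forall i, algebraicOver iota (u i)) ->
  ~ algebraicOver iota w -> qf chi ->
  exists2 r : {poly K}, r != 0 & forall w', ~~ root r w' ->
    (@sat C (field_structure cK) _ chi (vcat (fun _ : 'I_1 => w) u) <->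
     @sat C (field_structure cK) _ chi (vcat (fun _ : 'I_1 => w') u)).
Proof.
move=> ac au nw; pose A := subfield_algebraic iota.
have over t : term_poly cK u t \is a polyOver (subfield_pred A).
  elim: t => /= [i|c||| t It t' It'|t It|t It t' It'].
  - case: split => [_|j]; first exact: polyOverX.
    by rewrite polyOverC; apply/mem_set; exact: au.
  - by rewrite polyOverC; apply/mem_set; exact: ac.
  - exact: rpred0.
  - exact: rpred1.
  - exact: rpredD.
  - by rewrite rpredN.
  - exact: rpredM.
apply: (@sat_generic _ _ cK _ chi (fun w' => vcat (fun _ : 'I_1 => w') u)) => t t'.
pose P := term_poly cK u t - term_poly cK u t'.
have PE w' : root P w' <-> @eval C (field_structure cK) _ (vcat (fun _ : 'I_1 => w') u) t =
    @eval C (field_structure cK) _ (vcat (fun _ : 'I_1 => w') u) t'.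
  by rewrite rootE !hornerE !horner_term_poly subr_eq0; split=> /eqP.
have [P0|P0] := eqVneq P 0.
  by exists 1; rewrite ?oner_eq0 // => w' _; rewrite -!PE P0 !root0.
exists P => // w' nPw'; rewrite -!PE (negPf nPw'); split=> // Pw; case: nw.
apply: algebraic_root P0 Pw _ => i; have /polyOverP/(_ i) : P \is a polyOver (subfield_pred A).
  by rewrite rpredB.
by move/set_mem.
Qed.

(** For infinite [F] of positive characteristic, [adjoin iota z] need not contain [s]. It contains
    the powers [u] and the witness [w], which yield roots [s'] of the [rho (u i)] in [L]; these
    satisfy [eta] because the Frobenius twist of [eta] transfers along [rho]. *)
Lemma simple_extension C (Sigma : set (sentence C)) (K F : fieldType) (cK : C -> K)
    (iota : {rmorphism F -> K}) n (x : 'I_n -> K) (phi : formula C n) (K' : set K) :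
  @field_theory C `<=` Sigma ->
  (forall p n m : nat, prime p -> (1 <= n)%N -> (1 <= m)%N ->
     natinf_le (rk_ex (theory_char Sigma p) (pi_formula C n (p ^ m))) 1) ->
  models (field_structure cK) Sigma ->
  (forall c, exists b, iota b = cK c) -> (forall i, exists b, iota b = x i) ->
  subfield K' -> (forall c, K' (cK c)) -> (forall i, K' (x i)) ->
  (forall a, K' a -> algebraicOver iota a) ->
  (forall (L : fieldType) (cL : C -> L), models (field_structure cL) Sigma ->
     forall rho : K -> L,
     @embedding_on C (field_structure cK) (field_structure cL) K' rho ->
     @sat C (field_structure cL) n phi (fun i => rho (x i))) ->
  exists2 z, algebraicOver iota z &
    forall (L : fieldType) (cL : C -> L), models (field_structure cL) Sigma ->
    forall rho : K -> L,
    @embedding_on C (field_structure cK) (field_structure cL) (adjoin iota z) rho ->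
    @sat C (field_structure cL) n phi (fun i => rho (x i)).
Proof.
move=> Sf Spi hK cF xF sK' cK' xK' aK' H.
have [k [s [eta [qeta sK eta_s Heta]]]] := positive_diagram Sf sK' cK' xK' H.
have as_ i : algebraicOver iota (s i) by exact/aK'/sK.
have cz z c : adjoin iota z (cK c) by have [b <-] := cF c; exact: adjoin_base.
have xz z i : adjoin iota z (x i) by have [b <-] := xF i; exact: adjoin_base.
(* This settles every case in which all of [s] lies in a simple extension. *)
have simple : (exists2 z, algebraicOver iota z & forall i, adjoin iota z (s i)) ->
  exists2 z, algebraicOver iota z &
    forall (L : fieldType) (cL : C -> L), models (field_structure cL) Sigma ->
    forall rho : K -> L,
    @embedding_on C (field_structure cK) (field_structure cL) (adjoin iota z) rho ->
    @sat C (field_structure cL) n phi (fun i => rho (x i)).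
  move=> [z az zs]; exists z => // L cL hL rho er.
  apply: (Heta L cL hL (fun i => rho (s i))); rewrite -(comp_vcat rho).
  apply/(sat_embedding (subfield_adjoin az) (cz z) er _ (qf_pos_qf qeta)) => //.
  by move=> i; rewrite /vcat; case: split.
have [linf|nlinf] := pselect (large iota); last first.
  apply: simple; have [|z az zs] := primitive_element_finite (ss := codom s) nlinf.
    by move=> _ /codomP[i ->].
  by exists z => // i; apply/zs/codom_f.
have [[p pF]|nF] := pselect (exists p, p \in [pchar F]); last first.
  have F0 : [pchar F] =i pred0.
    by move=> p; apply/negP => pF; apply: nF; exists p.
  apply: simple.
  have [|z az [_ zs]] := primitive_element_seq (ys := codom s) linf (algebraic0 iota).
    by move=> _ /codomP[i ->]; have [f f0 fs] := as_ i; exact: separable_pchar0 F0 f0 fs.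
  by exists z => // i; apply/zs/codom_f.
have pK : p \in [pchar K] by rewrite (fmorph_pchar iota).
have pp := pcharf_prime pF.
(* The hypothesis on [pi_formula] concerns at least one variable, so an empty [s] is treated
   apart. *)
have [k0|k0] := posnP k.
  apply: simple; exists 0; first exact: algebraic0.
  by move=> i; move: (ltn_ord i); rewrite {2}k0.
have /choice[m hm] i : exists m, exists q, separable_poly q /\
    root (map_poly iota q) (s i ^+ (p ^ m)).
  by have [f f0 fs] := as_ i; exact: separable_power pF f0 fs.
(* [M] bounds every [m i], so each [u i] is a power of a separable element; the successor makes the
   exponent positive, as the hypothesis requires. *)
pose M := (\sum_i m i).+1; pose Q := (p ^ M)%N; pose u i := s i ^+ Q.
have mM i : (m i <= M)%N by rewrite /M (bigD1 i) //= -addSn ltnW // ltnS leq_addr.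
have uE i : u i = (s i ^+ (p ^ m i)) ^+ (p ^ (M - m i)).
  by rewrite -exprM -expnD subnKC.
have [chi qchi Hchi] := rk_ex_le1 (Spi p k M pp k0 isT).
have KSp := models_theory_char (pcharf0 pK) hK.
have piu : @sat C (field_structure cK) _ (pi_formula C k Q) u.
  by apply/sat_pi_formula; exists s.
have /(Hchi _ KSp) /(@sat_exs _ _ _ 1)[w0 chiw0] := piu.
have au i : algebraicOver iota (u i).
  by apply: (adjoin_algebraic (as_ i)); apply/adjoin_exp/adjoin_gen.
have ac c : algebraicOver iota (cK c) by have [b <-] := cF c; exact: algebraic_id.
(* If [w0] is transcendental over [F], then [chi] still holds outside finitely many points, hence at
   some point of the infinite field [F]. *)
have [w aw chiw] : exists2 w, algebraicOver iota w &
    @sat C (field_structure cK) _ chi (vcat (fun _ : 'I_1 => w) u).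
  have ew0 : w0 = (fun _ : 'I_1 => w0 ord0) by apply: funext => i; rewrite ord1.
  rewrite ew0 in chiw0; have [aw|naw] := pselect (algebraicOver iota (w0 ord0)).
    by exists (w0 ord0).
  have [r r0 hr] := sat_transcendental ac au naw qchi.
  have [c /hr hc] := linf r r0; exists (iota c); first exact: algebraic_id.
  exact/hc.
(* [w] is the only generator that may be inseparable. *)
have [|z az [zw zy]] := primitive_element_seq
    (ys := codom (fun i => s i ^+ (p ^ m i))) linf aw.
  by move=> _ /codomP[i ->]; have [q []] := hm i; exists q.
have zu i : adjoin iota z (u i).
  by rewrite uE; apply/adjoin_exp/zy/codomP; exists i.
exists z => // L cL hL rho er.
have sz := subfield_adjoin az.
have pL : p \in [pchar L].
  have := embedding_eval sz (cz z) er (e := @noval K)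
    (fun i => False_rect _ (notF (ltn_ord i))) (nat_term C 0 p).
  rewrite !eval_nat_term (pcharf0 pK) => -[_ p0].
  by rewrite inE pp p0 (emb_zero er) /=.
have LSp := models_theory_char (pcharf0 pL) hL.
have : @sat C (field_structure cL) _ (pi_formula C k Q) (fun i => rho (u i)).
  apply/(Hchi _ LSp)/(@sat_exs _ _ _ 1); exists (fun=> rho w).
  rewrite -(comp_vcat rho (fun _ : 'I_1 => w)).
  apply/(sat_embedding sz (cz z) er _ qchi) => //.
  by move=> i; rewrite /vcat; case: split.
move=> /sat_pi_formula[s' us']; apply: (Heta L cL hL s').
apply/(sat_pow_csts _ M _ pL (qf_pos_qf qeta)).
move/(sat_pow_csts _ M _ pK (qf_pos_qf qeta)): eta_s.
move/(sat_embedding sz (cz z) er) => eta_s.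
apply: sat_ext (eta_s _ _); last exact/qf_map_terms/qf_pos_qf.
  move=> i; rewrite /vcat; case: split => j; first by rewrite -us'.
  have rX a l : adjoin iota z a -> rho (a ^+ l) = rho a ^+ l.
    move=> za; elim: l => [|l IHl]; first exact: (emb_one er).
    by rewrite !exprS -IHl; apply: (emb_mul er) => //; exact: adjoin_exp.
  exact: rX.
by move=> i; rewrite /vcat; case: split => j //; [exact: zu|exact/adjoin_exp].
Qed.


(** * Simple extensions as unions of finitely generated rings *)

(** The subring [Z[C, e]] of [K]. *)
Definition term_ring C (K : fieldType) (cK : C -> K) N (e : 'I_N -> K) : set K :=
  range (@eval C (field_structure cK) N e).

Section TermRing.
Variables (C : Type) (K : fieldType) (cK : C -> K).
Local Notation R := (term_ring cK).

Lemma term_ring_var N (e : 'I_N -> K) i : R e (e i).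
Proof. by exists (Var i). Qed.

Lemma term_ring_cst N (e : 'I_N -> K) c : R e (cK c).
Proof. by exists (Cst c). Qed.

Lemma term_ring0 N (e : 'I_N -> K) : R e 0. Proof. by exists Zero. Qed.

Lemma term_ring1 N (e : 'I_N -> K) : R e 1. Proof. by exists One. Qed.

Lemma term_ringN N (e : 'I_N -> K) a : R e a -> R e (- a).
Proof. by move=> [t _ <-]; exists (Opp t). Qed.

Lemma term_ringD N (e : 'I_N -> K) a b : R e a -> R e b -> R e (a + b).
Proof. by move=> [t _ <-] [u _ <-]; exists (Add t u). Qed.

Lemma term_ringB N (e : 'I_N -> K) a b : R e a -> R e b -> R e (a - b).
Proof. by move=> Ra Rb; apply/term_ringD/term_ringN. Qed.

Lemma term_ringM N (e : 'I_N -> K) a b : R e a -> R e b -> R e (a * b).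
Proof. by move=> [t _ <-] [u _ <-]; exists (Mul t u). Qed.

Lemma term_ringX N (e : 'I_N -> K) a k : R e a -> R e (a ^+ k).
Proof. by move=> Ra; elim: k => [|k IHk]; [exact: term_ring1|rewrite exprS; exact: term_ringM]. Qed.

Lemma term_ring_sum N (e : 'I_N -> K) I (r : seq I) (P : pred I) (F : I -> K) :
  (forall i, P i -> R e (F i)) -> R e (\sum_(i <- r | P i) F i).
Proof. by move=> h; apply: big_ind => //; [exact: term_ring0|exact: term_ringD]. Qed.

Lemma term_ring_scons N (e : 'I_N -> K) z : R e `<=` R (scons z e).
Proof.
move=> _ [t _ <-]; exists (term_subst (fun i => Var (lift ord0 i)) t) => //.
rewrite eval_subst /= (_ : (fun i => scons z e (lift ord0 i)) = e) //.
by apply: funext => i; rewrite /scons liftK.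
Qed.

Lemma term_ring_scons0 N (e : 'I_N -> K) z : R (scons z e) z.
Proof. by exists (Var ord0) => //=; rewrite /scons unlift_none. Qed.

(** The fraction field of the ring inside [K]; as a subfield it contains all that its elements
    generate. *)
Lemma subfield_fractions N (e : 'I_N -> K) :
  subfield [set b | exists r s, [/\ R e r, R e s, s != 0 & b = r / s]].
Proof.
apply: mk_subfield.
- by exists 1, 1; rewrite divr1 oner_eq0; split=> //; exact: term_ring1.
- move=> _ _ [r [s [Rr Rs s0 ->]]] [r' [s' [Rr' Rs' s'0 ->]]].
  exists (r * s' - r' * s), (s * s'); split; last by rewrite -mulNr addf_div // mulNr.
  + by apply: term_ringB; apply: term_ringM.
  + exact: term_ringM.
  + exact: mulf_neq0.
move=> _ _ [r [s [Rr Rs s0 ->]]] [r' [s' [Rr' Rs' s'0 ->]]].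
have [->|r'0] := eqVneq r' 0.
  exists 0, 1; rewrite !mul0r invr0 mulr0 oner_eq0; split=> //; [exact: term_ring0|exact: term_ring1].
exists (r * s'), (s * r'); split; [exact: term_ringM|exact: term_ringM|exact: mulf_neq0|].
by rewrite invf_div mulf_div.
Qed.

Lemma term_ring_fraction N (e : 'I_N -> K) a : R e a ->
  exists r s, [/\ R e r, R e s, s != 0 & a = r / s].
Proof. by move=> Ra; exists a, 1; rewrite divr1 oner_eq0; split=> //; exact: term_ring1. Qed.

Section Adjunction.
Variables (F : fieldType) (iota : {rmorphism F -> K}) (N : nat) (e : 'I_N -> K).
Hypothesis frac : forall b : F, exists r s,
  [/\ R e r, R e s, s != 0 & iota b = r / s].

Lemma common_denominator (bs : seq F) : exists g,
  [/\ R e g, g != 0 & forall b, b \in bs -> R e (g * iota b)].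
Proof.
elim: bs => [|b bs [g [Rg g0 hg]]].
  by exists 1; split=> //; [exact: term_ring1|exact: oner_neq0].
have [r [s [Rr Rs s0 eb]]] := frac b.
exists (s * g); split; [exact: term_ringM|exact: mulf_neq0|].
move=> c; rewrite inE => /predU1P[->|/hg Rc]; last by rewrite -mulrA; exact: term_ringM.
by rewrite eb mulrAC [s * _]mulrC divfK //; exact: term_ringM.
Qed.

(* If [a] has leading coefficient [l] over the ring, [z = 1 / (l^2 g a)] works:
   dividing the equation of [a] by [a^(D-1)] puts [l a] in the ring of [z],
   whence [1 / (l g) = (l a) z], and then [1 / l], [a] and [1 / g]. *)
Lemma adjoin_term_ring k (s : 'I_k -> K) a : algebraicOver iota a ->
  (forall i, adjoin iota a (s i)) -> exists z, forall i, R (scons z e) (s i).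
Proof.
(* The witness [z] will involve the inverse of [a]; the extension generated by [0] is also generated
   by [1]. *)
wlog a0 : a / a != 0 => [hw|].
  have [->|a0] := eqVneq a 0; last exact: hw.
  move=> _ hs; apply: (hw 1) => [||i]; [exact: oner_neq0|exact: algebraic1|].
  by have [q <-] := hs i; rewrite horner_coef0 coef_map; exact: adjoin_base.
move=> [f f0 fa] /choice[q hq].
(* One [g] is to clear the denominators of the equation of [a] and of the polynomials expressing
   [s]. *)
pose bs := (f : seq F) ++ flatten [seq polyseq (q i) | i <- enum 'I_k].
have [g [Rg g0 hg]] := common_denominator bs.
have Rf i : R e (g * iota f`_i).
  have [fi|fi] := ltnP i (size f); last by rewrite nth_default // rmorph0 mulr0; exact: term_ring0.
  by apply: hg; rewrite mem_cat mem_nth.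
have Rq j i : R e (g * iota (q j)`_i).
  have [fi|fi] := ltnP i (size (q j)); last first.
    by rewrite nth_default // rmorph0 mulr0; exact: term_ring0.
  apply: hg; rewrite mem_cat; apply/orP; right; apply/flattenP.
  by exists (polyseq (q j)); [apply: map_f; rewrite mem_enum|exact: mem_nth].
have [D sD] : exists D, size f = D.+2.
  have : (1 < size (map_poly iota f))%N by apply: root_size_gt1 fa; rewrite map_poly_eq0.
  by rewrite size_map_poly; case: (size f) => [|[|D]] // _; exists D.
pose l := g * iota (lead_coef f).
have l0 : l != 0 by rewrite mulf_neq0 // fmorph_eq0 lead_coef_eq0.
pose z := (l ^+ 2 * g * a)^-1; exists z.
have sub := @term_ring_scons N e z; have Rz := term_ring_scons0 e z.
have Rl : R (scons z e) l by apply: sub; rewrite /l lead_coefE; exact: Rf.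
have Rg' : R (scons z e) g by exact: sub.
have RaV : R (scons z e) a^-1.
  have -> : a^-1 = l ^+ 2 * g * z.
    by rewrite /z invfM mulrA divff ?mul1r // mulf_neq0 // expf_neq0.
  by apply: term_ringM => //; apply: term_ringM => //; exact: term_ringX.
have Rla : R (scons z e) (l * a).
  have : l * a = - \sum_(i < D.+1) g * iota f`_i * a^-1 ^+ (D - i).
    move/rootP: fa; rewrite (@horner_coef_wide _ D.+2); last by rewrite size_map_poly sD.
    rewrite big_ord_recr /= coef_map /= => /eqP; rewrite addrC addr_eq0 => /eqP h.
    apply: (mulIf (expf_neq0 D a0)); rewrite /l lead_coefE sD /= -!mulrA -exprS.
    rewrite h mulrN mulNr mulr_sumr mulr_suml; congr (- _); apply: eq_bigr => i _.
    rewrite coef_map -!mulrA; congr (_ * (_ * _)).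
    have iD : (i <= D)%N by rewrite -ltnS.
    have -> : a ^+ D = a ^+ (D - i) * a ^+ i by rewrite -exprD subnK.
    by rewrite mulrA exprVn mulVf ?mul1r // expf_neq0.
  move=> ->; apply/term_ringN/term_ring_sum => i _; apply: term_ringM; first exact/sub/Rf.
  exact: term_ringX.
have Rlg : R (scons z e) (l * g)^-1.
  have -> : (l * g)^-1 = l * a * z.
    rewrite /z; apply: (mulfI (mulf_neq0 l0 g0)); rewrite divff; last exact: mulf_neq0.
    have E : l * g * (l * a) = l ^+ 2 * g * a.
      by rewrite mulrACA -expr2 mulrA.
    by rewrite mulrA E divff // (mulf_neq0 (mulf_neq0 (expf_neq0 2 l0) g0) a0).
  exact: term_ringM.
have Ra : R (scons z e) a.
  have -> : a = l * a * (g * (l * g)^-1).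
    have -> : g * (l * g)^-1 = l^-1 by rewrite invfM mulrCA divff // mulr1.
    by rewrite mulrAC divff // mul1r.
  by apply: term_ringM => //; exact: term_ringM.
have RgV : R (scons z e) g^-1.
  have -> : g^-1 = l * (l * g)^-1 by rewrite invfM mulrA divff // mul1r.
  exact: term_ringM.
move=> i; rewrite -hq horner_coef; apply: term_ring_sum => j _.
rewrite coef_map /= -[iota _](mulKf g0).
apply: term_ringM; last exact: term_ringX.
by apply: term_ringM => //; exact/sub/Rq.
Qed.

End Adjunction.
End TermRing.

(** Each [s i] is the value of a term [tau i] in [z], [t] and [x]; substituting these terms in [eta]
    leaves only the [d + 1] unknowns [z] and [t]. *)
Lemma simple_extension_formula C (Sigma : set (sentence C)) (K F : fieldType)
    (cK : C -> K) (iota : {rmorphism F -> K}) n (x : 'I_n -> K) d (t : 'I_d -> K)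
    (phi : formula C n) a :
  @field_theory C `<=` Sigma ->
  (forall b : F, exists r s, [/\ term_ring cK (vcat t x) r,
     term_ring cK (vcat t x) s, s != 0 & iota b = r / s]) ->
  (forall c, exists b, iota b = cK c) -> (forall i, exists b, iota b = x i) ->
  algebraicOver iota a ->
  (forall (L : fieldType) (cL : C -> L), models (field_structure cL) Sigma ->
     forall rho : K -> L,
     @embedding_on C (field_structure cK) (field_structure cL) (adjoin iota a) rho ->
     @sat C (field_structure cL) n phi (fun i => rho (x i))) ->
  exists theta : formula C (d.+1 + n), [/\ qf_pos theta,
    @sat C (field_structure cK) n (exs theta) x &
    forall (L : fieldType) (cL : C -> L), models (field_structure cL) Sigma ->
    forall x' : 'I_n -> L, @sat C (field_structure cL) n (exs theta) x' ->
      @sat C (field_structure cL) n phi x'].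
Proof.
move=> Sf frac cF xF aa H.
have [||k [s [eta [qeta sa eta_s Heta]]]] :=
    positive_diagram (x := x) Sf (subfield_adjoin aa) _ _ H.
- by move=> c; have [b <-] := cF c; exact: adjoin_base.
- by move=> i; have [b <-] := xF i; exact: adjoin_base.
have [z hz] := adjoin_term_ring frac aa sa.
have /choice[tau htau] i : exists tau : term C (d.+1 + n),
    @eval C (field_structure cK) _ (vcat (scons z t) x) tau = s i.
  by have [tau _ <-] := hz i; exists tau; rewrite -scons_vcat.
pose g := vcat tau (fun i => Var (rshift d.+1 i)).
exists (map_terms eta (term_subst g)); split; first exact: qf_pos_map_terms.
  apply/(@sat_exs _ _ _ d.+1); exists (scons z t); apply/sat_subst; first exact: qf_pos_qf.
  apply: sat_ext eta_s => i; rewrite /g; case: (split_ordP i) => j ->.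
    by rewrite !vcat_lshift htau.
  by rewrite !vcat_rshift /= (vcat_rshift (scons z t) x).
move=> L cL hL x' /(@sat_exs _ _ _ d.+1)[v] /sat_subst h.
apply: (Heta L cL hL (fun i => @eval C (field_structure cL) _ (vcat v x') (tau i))).
apply: sat_ext (h (qf_pos_qf qeta)) => i; rewrite /g.
case: (split_ordP i) => j ->; first by rewrite !vcat_lshift.
by rewrite !vcat_rshift /= (vcat_rshift v x').
Qed.


(** * Transcendence bases *)

Lemma subfield_algebraic_over (K : fieldType) (G : set K) :
  subfield G -> subfield [set a | algebraic_over G a].
Proof.
move=> sG; suff -> : [set a | algebraic_over G a] =
    [set a | algebraicOver (subfield_inj sG) a] by exact: subfield_algebraic.
by apply/seteqP; split=> a /= /(algebraic_overP sG).
Qed.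

Lemma algebraic_over_id (K : fieldType) (G : set K) a :
  subfield G -> G a -> algebraic_over G a.
Proof.
move=> sG Ga; apply/(algebraic_overP sG).
by have [b <-] := subfield_inj_onto sG Ga; exact: algebraic_id.
Qed.

Lemma algebraic_over_trans (K : fieldType) (G H : set K) a : subfield G ->
  H `<=` [set b | algebraic_over G b] -> algebraic_over H a -> algebraic_over G a.
Proof.
move=> sG HG [p [p0 pH pa]]; apply/(algebraic_overP sG).
by apply: algebraic_root p0 pa _ => i; apply/(algebraic_overP sG)/HG.
Qed.

Lemma gen_subfieldS (K : fieldType) (A B : set K) :
  A `<=` B -> gen_subfield A `<=` gen_subfield B.
Proof.
move=> AB; apply: gen_subfield_min; first exact: gen_subfield_subfield.
by apply: subset_trans AB _; exact: sub_gen_subfield.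
Qed.

Lemma algebraic_over_gen (K : fieldType) (G A : set K) : subfield G ->
  A `<=` [set b | algebraic_over G b] ->
  gen_subfield A `<=` [set b | algebraic_over G b].
Proof. by move=> sG AG; apply: gen_subfield_min => //; exact: subfield_algebraic_over. Qed.

Local Notation widen := (widen_ord (leqnSn _)).

Lemma muni_coef (R : nzRingType) m (p : {mpoly R[m.+1]}) k mu :
  (muni p)`_k@_mu = \sum_(nu <- msupp p)
    (p@_nu *+ ([multinom nu (widen i) | i < m] == mu) *+ (k == nu ord_max)).
Proof.
rewrite muniE coef_sum raddf_sum /=; apply: eq_bigr => nu _.
rewrite coefZ coefXn mulr_natr; case: (k == _) => /=; last by rewrite mulr0n mcoeff0.
by rewrite !mulr1n mcoeffZ mcoeffX mulr_natr.
Qed.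

(** A monomial is determined by its last exponent and the remaining ones, so distinct terms of [p]
    do not cancel in [muni p]. *)
Lemma muni_neq0 (R : nzRingType) m (p : {mpoly R[m.+1]}) : p != 0 -> muni p != 0.
Proof.
move=> p0; have [nu nup] : exists nu, nu \in msupp p.
  case E : (msupp p) => [|nu s]; last by exists nu; rewrite mem_head.
  by move/eqP: E; rewrite msupp_eq0 (negPf p0).
apply: contraTneq nup => e; rewrite -mcoeff_eq0.
have := muni_coef p (nu ord_max) [multinom nu (widen i) | i < m].
rewrite e coef0 mcoeff0; have [nup|/memN_msupp_eq0->//] := boolP (nu \in msupp p).
rewrite (big_rem nu) //= !eqxx !mulr1n big1_seq ?addr0 => [->//|nu' /= nu'p].
case: eqP => [e1|_]; case: eqP => [e2|_]; rewrite ?mulr0n ?mul0rn // !mulr1n.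
suff eq : nu' = nu by move: nu'p; rewrite eq mem_rem_uniqF ?msupp_uniq.
apply/mnmP => i; have [[j ->]|->] : (exists j, i = widen j) \/ i = ord_max.
- have [im|mi] := ltnP i m; first by left; exists (Ordinal im); apply: val_inj.
  by right; apply: val_inj; apply/eqP; rewrite eqn_leq mi -ltnS ltn_ord.
- by move/mnmP/(_ j): e1; rewrite !mnmE.
- by rewrite e2.
Qed.

Lemma meval_muni (R : comNzRingType) m (p : {mpoly R[m.+1]}) (t : 'I_m.+1 -> R) :
  p.@[t] = (map_poly (meval (fun i => t (widen i))) (muni p)).[t ord_max].
Proof.
rewrite muniE rmorph_sum horner_sum mevalE /=; apply: eq_bigr => nu _.
rewrite map_polyZ map_polyXn hornerZ hornerXn /= mevalZ mevalX big_ord_recr /= mulrA.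
by congr (_ * _ * _); apply: eq_bigr => i _; rewrite mnmE.
Qed.

(* A polynomial relation is eliminated one variable at a time: either it gives an
   equation for the last coordinate, or one of its coefficients is a relation
   among the other ones. *)
Lemma mpoly_relation_algebraic (K : fieldType) (F : set K) m (p : {mpoly K[m]})
    (t : 'I_m -> K) : subfield F ->
  p != 0 -> (forall mu, F p@_mu) -> p.@[t] = 0 ->
  exists i, algebraic_over (gen_subfield (F `|` [set t j | j in [set j | j != i]])) (t i).
Proof.
move=> sF; elim: m p t => [|m IHm] p t p0 pF pt.
  have [c pc] : exists c, p = c%:MP.
    exists p@_0%MM; apply/mpolyP => mu; rewrite mcoeffC (_ : mu = 0%MM) ?eqxx ?mulr1 //.
    by apply/mnmP => -[].
  by move: pt p0; rewrite pc mevalC => ->; rewrite mpolyC0 eqxx.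
pose t' i := t (widen i).
have cF k mu : F (muni p)`_k@_mu.
  rewrite muni_coef; apply: big_ind => [|a b|nu _]; [exact: subfield0|exact: subfieldD|].
  by do 2 case: eqP => _; rewrite ?mulr1n ?mulr0n ?mul0rn //; exact: subfield0.
have [Q0|Q0] := eqVneq (map_poly (meval t') (muni p)) 0.
  have qk : (muni p)`_(size (muni p)).-1 != 0 by rewrite -lead_coefE lead_coef_eq0 muni_neq0.
  have [|i hi] := IHm _ t' qk (cF _).
    by have := congr1 (fun q : {poly K} => q`_(size (muni p)).-1) Q0; rewrite coef_map coef0.
  exists (widen i); move: hi => [q [q0 qF qt]]; exists q; split=> // l.
  apply: gen_subfieldS (qF l) => b [Fb|[j ji <-]]; first by left.
  by right; exists (widen j).
exists ord_max, (map_poly (meval t') (muni p)); split=> //; last by rewrite rootE -meval_muni pt.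
move=> l; rewrite coef_map /= mevalE.
have sG := gen_subfield_subfield (F `|` [set t j | j in [set j | j != ord_max]]).
apply: (big_ind (gen_subfield _)) => [|a b Ga Gb|nu _]; first exact: (subfield0 sG).
  exact: (subfieldD sG).
apply: (subfieldM sG); first by apply: sub_gen_subfield; left.
apply: (big_ind (gen_subfield _)) => [|a b Ga Gb|i _]; first exact: (subfield1 sG).
  exact: (subfieldM sG).
elim: (nu _) => [|c IHc]; first exact: (subfield1 sG).
rewrite exprS; apply: (subfieldM sG) => //; apply: sub_gen_subfield; right.
by exists (widen i) => //=; rewrite -val_eqE /= ltn_eqF.
Qed.

(** As long as the family is dependent, a member algebraic over the others is dropped. *)
Lemma exists_transcendence_basis (K : fieldType) (F : set K) m (y : 'I_m -> K) :
  subfield F -> exists e (t : 'I_e -> K),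
  [/\ (e <= m)%N, ~ alg_independent F y -> (e < m)%N,
      forall i, exists j, t i = y j, alg_independent F t &
      forall j, algebraic_over (gen_subfield (F `|` range t)) (y j)].
Proof.
move=> sF; elim: m y => [|m IHm] y.
  exists 0%N, y; split=> //; last by case.
  - move=> []; move=> p pF py; apply: contrapT => /eqP p0.
    by have [[]] := mpoly_relation_algebraic sF p0 pF py.
  - by case.
  - move=> p pF py; apply: contrapT => /eqP p0.
    by have [[]] := mpoly_relation_algebraic sF p0 pF py.
have [iy|niy] := pselect (alg_independent F y).
  exists m.+1, y; split=> //; first by move=> i; exists i.
  move=> j; apply: algebraic_over_id; first exact: gen_subfield_subfield.
  by apply: sub_gen_subfield; right; exists j.
have [i hi] : exists i, algebraic_over
    (gen_subfield (F `|` [set y j | j in [set j | j != i]])) (y i).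
  move/existsNP: niy => [p /not_implyP[pF /not_implyP[py /eqP p0]]].
  exact: mpoly_relation_algebraic sF p0 pF py.
have [e [t [em _ ty it at_]]] := IHm (fun j => y (lift i j)).
exists e, t; split=> //.
- exact: leq_trans em (leqnSn _).
- by move=> l; have [j ->] := ty l; exists (lift i j).
have sG := gen_subfield_subfield (F `|` range t).
move=> j; have [l ->|->] := unliftP i j; first exact: at_.
(* The dropped [y i] is algebraic over the other members, which are algebraic over the basis. *)
apply: (algebraic_over_trans sG _ hi); apply: (algebraic_over_gen sG) => b [Fb|[l li <-]].
  by apply: algebraic_over_id => //; apply: sub_gen_subfield; left.
by move: li => /=; case: (unliftP i l) => [l' -> _|->]; [exact: at_|rewrite eqxx].
Qed.

(** * From positive formulas to fibres *)

Lemma sat_pos_transfer C (M N : structure C) n (f : formula C n)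
    (e : 'I_n -> M) (e' : 'I_n -> N) :
  (forall t u, eval e t = eval e u -> eval e' t = eval e' u) ->
  qf_pos f -> sat f e -> sat f e'.
Proof.
elim: f e e' => {n} //= [n t u|n f IHf g IHg|n f IHf g IHg] e e' H.
- by move=> _; exact: H.
- by case/andP=> /(IHf e e' H) hf /(IHg e e' H) hg [/hf ? /hg].
- by case/andP=> /(IHf e e' H) hf /(IHg e e' H) hg [/hf|/hg]; [left|right].
Qed.

Fixpoint term_mpoly C (K : fieldType) (cK : C -> K) m n (x : 'I_n -> K)
    (t : term C (m + n)) : {mpoly K[m]} :=
  match t with
  | Var i => match split i with inl j => 'X_j | inr j => (x j)%:MP end
  | Cst c => (cK c)%:MP
  | Zero => 0
  | One => 1
  | Add t t' => term_mpoly cK x t + term_mpoly cK x t'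
  | Opp t => - term_mpoly cK x t
  | Mul t t' => term_mpoly cK x t * term_mpoly cK x t'
  end.

Lemma meval_term_mpoly C (K : fieldType) (cK : C -> K) m n (x : 'I_n -> K)
    (t : term C (m + n)) (y : 'I_m -> K) :
  (term_mpoly cK x t).@[y] = @eval C (field_structure cK) _ (vcat y x) t.
Proof.
elim: t => /= [i|c||| t <- t' <-|t <-|t <- t' <-].
- by rewrite /vcat; case: split => j; rewrite ?mevalXU ?mevalC.
- by rewrite mevalC.
- by rewrite meval0.
- by rewrite meval1.
- by rewrite mevalD.
- by rewrite mevalN.
- by rewrite mevalM.
Qed.

(* The equations satisfied by an independent point are identities. *)
Lemma sat_pos_independent C (K : fieldType) (cK : C -> K) (F : set K) m n
    (x : 'I_n -> K) (y y' : 'I_m -> K) (f : formula C (m + n)) :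
  subfield F -> (forall c, F (cK c)) -> (forall i, F (x i)) ->
  alg_independent F y -> qf_pos f ->
  @sat C (field_structure cK) _ f (vcat y x) ->
  @sat C (field_structure cK) _ f (vcat y' x).
Proof.
move=> sF cF xF iy; apply: sat_pos_transfer => t u.
have over v : term_mpoly cK x v \is a mpolyOver m (subfield_pred sF).
  elim: v => /= [i|c||| v Iv v' Iv'|v Iv|v Iv v' Iv'].
  - case: split => [j|j]; first exact: mpolyOverX.
    by rewrite mpolyOverC; apply/mem_set.
  - by rewrite mpolyOverC; apply/mem_set.
  - exact: rpred0.
  - exact: rpred1.
  - exact: rpredD.
  - by rewrite rpredN.
  - exact: rpredM.
rewrite -!meval_term_mpoly => /eqP; rewrite -subr_eq0 -mevalB => /eqP e.
have : term_mpoly cK x t - term_mpoly cK x u = 0.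
  apply: iy e => mu; apply/set_mem.
  have /mpolyOverP : term_mpoly cK x t - term_mpoly cK x u \is a mpolyOver m (subfield_pred sF).
    by rewrite rpredB.
  exact.
by move/eqP; rewrite subr_eq0 => /eqP->.
Qed.

Lemma fibre_dim_le_of_rank C (Sigma : set (sentence C)) n (phi : formula C n) m
    (chi : formula C (m + n)) :
  qf_pos chi -> equiv_mod Sigma phi (exs chi) -> fibre_dim_le Sigma phi (m - 1).
Proof.
move=> qchi Hchi K cK hK x /(Hchi _ hK) /sat_exs[y chiy] KCx.
have sF : subfield KCx by exact: gen_subfield_subfield.
have cF c : KCx (cK c) by apply: sub_gen_subfield; left; exists c.
have xF i : KCx (x i) by apply: sub_gen_subfield; right; exists i.
(* If [y] is independent, [chi] also holds with [0] for [y], so [KCx] works, with the empty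
   transcendence basis. *)
have [iy|niy] := pselect (alg_independent KCx y).
  exists KCx; split=> //.
    have [e [t [e0 _ _ it _]]] := exists_transcendence_basis (@noval K) sF.
    exists e, t; split; first by move: e0; rewrite leqn0 => /eqP->.
    split=> //; first by move=> i; move: e0; rewrite leqNgt (leq_ltn_trans _ (ltn_ord i)).
    move=> a Fa; apply: algebraic_over_id; first exact: gen_subfield_subfield.
    by apply: sub_gen_subfield; left.
  move=> L cL hL rho er; apply/(Hchi _ hL)/sat_exs; exists (fun=> rho 0).
  rewrite -(comp_vcat rho (fun _ : 'I_m => 0)).
  apply/(sat_embedding sF cF er _ (qf_pos_qf qchi)).
    by move=> i; rewrite /vcat; case: split => // _; exact: subfield0.
  exact: (sat_pos_independent (fun=> 0) sF cF xF iy qchi chiy).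
have [e [t [em elt ty it ay]]] := exists_transcendence_basis y sF.
pose E := gen_subfield (KCx `|` range y).
have sE : subfield E by exact: gen_subfield_subfield.
have FE : KCx `<=` E by move=> a Fa; apply: sub_gen_subfield; left.
have yE i : E (y i) by apply: sub_gen_subfield; right; exists i.
exists E; split=> //.
  (* Dependence of [y] makes [e] strictly less than [m], which rules out [m = 0] and gives
     [e <= m - 1]. *)
  exists e, t; split; first by have := elt niy; case: (m) => // m'; rewrite subn1.
  split=> //; first by move=> i; have [j ->] := ty i.
  apply: algebraic_over_gen; first exact: gen_subfield_subfield.
  move=> b [Fb|[j _ <-]]; last exact: ay.
  apply: algebraic_over_id; first exact: gen_subfield_subfield.
  by apply: sub_gen_subfield; left.
move=> L cL hL rho er; apply/(Hchi _ hL)/sat_exs; exists (fun i => rho (y i)).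
rewrite -(comp_vcat rho); apply/(sat_embedding sE _ er _ (qf_pos_qf qchi)) => //.
  by move=> c; exact: FE.
by move=> i; rewrite /vcat; case: split => j; [exact: yE|exact: FE].
Qed.


(** * From fibres to positive formulas *)

Lemma fibre_local_formula C (Sigma : set (sentence C)) n (phi : formula C n) d
    (K : fieldType) (cK : C -> K) (x : 'I_n -> K) :
  @field_theory C `<=` Sigma ->
  (forall p n m : nat, prime p -> (1 <= n)%N -> (1 <= m)%N ->
     natinf_le (rk_ex (theory_char Sigma p) (pi_formula C n (p ^ m))) 1) ->
  fibre_dim_le Sigma phi d -> models (field_structure cK) Sigma ->
  @sat C (field_structure cK) n phi x ->
  exists theta : formula C (d.+1 + n), [/\ qf_pos theta,
    @sat C (field_structure cK) n (exs theta) x &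
    forall (L : fieldType) (cL : C -> L), models (field_structure cL) Sigma ->
    forall x' : 'I_n -> L, @sat C (field_structure cL) n (exs theta) x' ->
      @sat C (field_structure cL) n phi x'].
Proof.
move=> Sf Spi Hd hK phix.
have [K' [sK' FK' [e [t [ed [tK' _ aK']]]] HK']] := Hd K cK hK x phix.
set KCx := gen_subfield _ in FK' aK'.
have cF c : KCx (cK c) by apply: sub_gen_subfield; left; exists c.
have xF i : KCx (x i) by apply: sub_gen_subfield; right; exists i.
pose G := gen_subfield (KCx `|` range t).
have sG : subfield G by exact: gen_subfield_subfield.
have FG : KCx `<=` G by move=> a Fa; apply: sub_gen_subfield; left.
pose iota := subfield_inj sG.
have cI c : exists b, iota b = cK c by exact: (subfield_inj_onto sG (FG _ (cF c))).
have xI i : exists b, iota b = x i by exact: (subfield_inj_onto sG (FG _ (xF i))).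
have [||a Ka|z az Hz] := simple_extension Sf Spi hK cI xI sK' _ _ _ HK'.
- by move=> c; exact: FK'.
- by move=> i; exact: FK'.
- exact/(algebraic_overP sG)/aK'.
(* The basis is padded with zeros, so that the number of unknowns depends on [d] alone. *)
pose t' (i : 'I_d) := if insub (i : nat) is Some j then t j else 0.
apply: (simple_extension_formula (t := t') Sf _ cI xI az Hz) => b.
have sQ := subfield_fractions cK (vcat t' x).
apply: (gen_subfield_min sQ _ (subfield_injP b)) => {}b [Fb|[j _ <-]]; last first.
  apply: term_ring_fraction.
  have -> : t j = vcat t' x (lshift n (widen_ord ed j)).
    rewrite vcat_lshift /t' insubT //= => jd; congr (t _); exact: val_inj.
  exact: term_ring_var.
apply: (gen_subfield_min sQ _ Fb) => {b Fb}b [[c _ <-]|[i _ <-]];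
  apply: term_ring_fraction; first exact: term_ring_cst.
by rewrite -(vcat_rshift t' x i); exact: term_ring_var.
Qed.

(** The local formulas at the points of all models cover [phi]; by compactness finitely many
    suffice, and their disjunction still has [d + 1] quantifiers. *)
Lemma rank_of_fibre_dim C (Sigma : set (sentence C)) n (phi : formula C n) d :
  @field_theory C `<=` Sigma ->
  (forall p n m : nat, prime p -> (1 <= n)%N -> (1 <= m)%N ->
     natinf_le (rk_ex (theory_char Sigma p) (pi_formula C n (p ^ m))) 1) ->
  fibre_dim_le Sigma phi d ->
  exists2 chi : formula C (d.+1 + n), qf_pos chi & equiv_mod Sigma phi (exs chi).
Proof.
move=> Sf Spi Hd.
pose P (theta : formula C (d.+1 + n)) := qf_pos theta /\
  forall M : structure C, models M Sigma -> forall e : 'I_n -> M,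
    sat (exs theta) e -> sat phi e.
apply: contrapT => hN.
pose cond (f : formula C n) : condition C 'I_n := existT _ n (f, id).
(* A model of [Phi] is a point of [phi] at which every formula in [P] fails, contrary to the
   existence of a local formula there. *)
pose Phi : set (condition C 'I_n) := [set a | a = cond phi \/
  exists2 theta, P theta & a = cond (Not (exs theta))].
have [l hl|M hM [e he]] := @compactness C 'I_n Sigma Phi.
  have [ts [tsP lts]] : exists ts : seq (formula C (d.+1 + n)),
      (forall th, List.In th ts -> P th) /\ forall a, List.In a l ->
        a = cond phi \/ exists2 th, List.In th ts & a = cond (Not (exs th)).
    elim: l hl => [|a l IHl] hl; first by exists [::].
    have [|ts [tsP lts]] := IHl; first by move=> b bl; apply: hl; right.
    case: (hl a (or_introl erefl)) => [->|[th Pth ->]].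
      by exists ts; split=> // b [<-|/lts //]; left.
    exists (th :: ts); split=> [th' [<-//|/tsP//]|b [<-|/lts[->|[th' th'ts ->]]]].
    - by right; exists th => //; left.
    - by left.
    - by right; exists th' => //; right.
  pose chi := \big[@Or C _/Eq Zero One]_(th <- ts) th.
  have qchi : qf_pos chi by apply: qf_pos_bigOr => th /tsP[].
  (* If [l] had no model, the disjunction [chi] of the formulas negated in [l] would be equivalent
     to [phi]. *)
  apply: contrapT => hM; case: hN; exists chi => // M hMS e.
  have M01 : szero M <> sone M by exact: (hMS _ (Sf _ (ax_nontrivial C))).
  split=> [phie|/(@sat_exs _ _ _ d.+1)[v /(sat_bigOr _ _ M01)[th thts hth]]]; last first.
    by have [_] := tsP th thts; apply=> //; apply/(@sat_exs _ _ _ d.+1); exists v.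
  apply: contrapT => nchi; case: hM; exists M => //; exists e => a /lts[->//|[th thts ->]] h.
  apply: nchi; have /(@sat_exs _ _ _ d.+1)[v hv] := h.
  by apply/(@sat_exs _ _ _ d.+1); exists v; apply/sat_bigOr => //; exists th.
have [L [cL eM]] := model_field_structure (fun s hs => hM s (Sf s hs)).
move: hM e he; rewrite {M}eM => hM e he.
have phie : @sat C (field_structure cL) n phi e by exact: (he (cond phi) (or_introl erefl)).
have [th [qth the Hth]] := fibre_local_formula Sf Spi Hd hM phie.
have Pth : P th.
  split=> // M hMS; have [L' [cL' eM]] := model_field_structure (fun s hs => hMS s (Sf s hs)).
  by move: hMS; rewrite eM => hL'; exact: Hth.
exact: (he (cond (Not (exs th))) (or_intror (ex_intro2 _ _ th Pth erefl))).
Qed.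

Local Close Scope ring_scope.

Theorem theorem4p16 (C : Type) (Sigma : set (sentence C))
    (Sigma_field : field_theory C `<=` Sigma)
    (Sigma_pi : forall p n m : nat, prime p -> 1 <= n -> 1 <= m ->
       natinf_le (rk_ex (theory_char Sigma p) (pi_formula C n (p ^ m))) 1)
    (n : nat) (phi : formula C n) (phi_ex : existential phi) :
  efd Sigma phi = omap (fun r => maxn (r - 1) 0) (rk_ex_pos Sigma phi).
Proof.
(* If the rank is infinite, a finite fibre dimension [d] would contradict the bound [d.+1] on the
   rank. *)
rewrite /rk_ex_pos; case Er : natinf => [r|] /=; last first.
  rewrite /efd; case Ed : natinf => [d|] //.
  have [Hd _] := natinf_Some Ed.
  have [chi qchi hchi] := rank_of_fibre_dim Sigma_field Sigma_pi Hd.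
  by case: (natinf_None Er (k := d.+1)); exists chi.
have [[chi qchi hchi] rmin] := natinf_Some Er.
have hr := fibre_dim_le_of_rank qchi hchi.
rewrite /efd maxn0; case Ed : natinf => [d|]; last by case: (natinf_None Ed hr).
have [Hd dmin] := natinf_Some Ed; congr Some; apply/eqP; rewrite eqn_leq dmin //=.
(* Conversely the rank [r] is at most [d.+1], that is, [r - 1 <= d]. *)
have [chi' qchi' hchi'] := rank_of_fibre_dim Sigma_field Sigma_pi Hd.
by rewrite leq_subLR add1n rmin //; exists chi'.
Qed.
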